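(* Let $n\ge1$. The sub-Riemannian (normal) geodesic flow corresponding to the standard left-invariant Riemannian metric on the Heisenberg group $H_{2n+1}$ and the right-invariant distribution $\mathcal{D}_R$ is a Hamiltonian system on $T^*H_{2n+1}$ with Hamiltonian function $$H=\frac12\Big(\bar\lambda^{T}\Big(\mathrm{Id}-\frac{1}{1+\langle q,q\rangle}(Jq)(Jq)^{T}\Big)\bar\lambda+2\lambda_{2n+1}\bar\lambda^{T}\Big(u+\frac{\langle u,u\rangle}{1+\langle q,q\rangle}Jq\Big)+\lambda_{2n+1}^2\Big(\langle u,u\rangle-\frac{\langle u,u\rangle^2}{1+\langle q,q\rangle}\Big)\Big),$$ integrable via the first integrals $$I_0=H,\qquad I_j=x_j\lambda_{n+j}-y_j\lambda_j+\tfrac12(x_j^2-y_j^2)\lambda_{2n+1},\qquad I_{n+k}=P_k^2+Q_k^2,\qquad I_{2n}=\lambda_{2n+1},$$ $$I_{2n+l}=\{I_{n+1},I_{n+l+1}\}=4\big(P_{l+1}(P_1R_{l+1}-Q_1S_{l+1})+Q_{l+1}(P_1S_{l+1}+Q_1R_{l+1})\big),$$ for $j=1,\dots,n$, $k=1,\dots,n-1$, $l=1,\dots,n-2$. These integrals are functionally independent almost everywhere. If $n=1$ or $n=2$, the set $\mathcal{F}$ of these first integrals is commutative (with respect to the Poisson bracket). For $n>2$, the system is integrable in the non-commutative sense, admitting $3n-1$ first integrals of degrees one, two and three in the momenta.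
   Context: Heisenberg group: $H_{2n+1}=\mathbb{R}^{2n+1}$ with coordinates $(x,y,z)=(x_1,\dots,x_n,y_1,\dots,y_n,z)$, identified with matrices $\begin{pmatrix}1&x^T&z\\0&I_n&y\\0&0&1\end{pmatrix}$ under matrix multiplication. The standard left-invariant metric is $g=\sum_{k}(dx_k^2+dy_k^2)+\big(dz-\sum_kx_k\,dy_k\big)^2$. The right-invariant distribution $\mathcal{D}_R$ is spanned by $\frac{\partial}{\partial x_k}+y_k\frac{\partial}{\partial z}$, $\frac{\partial}{\partial y_k}$, $k=1,\dots,n$; the sub-Riemannian metric is $g|_{\mathcal{D}_R}$. Normal geodesic flow: for a frame $X_a$ of the distribution with Gram matrix $(g_{ab})$ and inverse $(g^{ab})$, it is the Hamiltonian flow on the cotangent bundle of $\frac12\sum_{a,b}g^{ab}\lambda(X_a)\lambda(X_b)$. The Poisson bracket is canonical: $\{f,h\}=\sum_i\big(\frac{\partial f}{\partial q_i}\frac{\partial h}{\partial\lambda_i}-\frac{\partial f}{\partial\lambda_i}\frac{\partial h}{\partial q_i}\big)$ over all $2n+1$ coordinate pairs. Notation: $\lambda=(\bar\lambda,\lambda_{2n+1})$, $\bar\lambda=(\lambda_1,\dots,\lambda_{2n})$, are the momenta canonically conjugate to $(x,y,z)$ in this order; $q=(x,y)$, $u=(y,0)\in\mathbb{R}^{2n}$; $J=\begin{pmatrix} 0 & -E \\ E & 0 \end{pmatrix}$ with $E$ the $n\times n$ identity; $\mathrm{Id}$ is the $2n\times2n$ identity; $\langle\cdot,\cdot\rangle$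 is the standard inner product. For $1\le k<n$ and $2\le j<n$: $P_k=y_{k+1}\lambda_1-x_1\lambda_{n+k+1}+x_{k+1}\lambda_{n+1}-y_1\lambda_{k+1}$, $Q_k=x_1\lambda_{k+1}-x_{k+1}\lambda_1-y_1\lambda_{n+k+1}+y_{k+1}\lambda_{n+1}+(x_1y_{k+1}-x_{k+1}y_1)\lambda_{2n+1}$, $R_j=\{P_1,P_j\}=\{Q_1,Q_j\}=x_2\lambda_{j+1}-x_{j+1}\lambda_2+y_2\lambda_{n+j+1}-y_{j+1}\lambda_{n+2}$, $S_j=\{P_1,Q_j\}=\{P_j,Q_1\}=x_2\lambda_{n+j+1}+x_{j+1}\lambda_{n+2}-y_2\lambda_{j+1}-y_{j+1}\lambda_2+(x_2x_{j+1}-y_2y_{j+1})\lambda_{2n+1}$. Integrability: on a symplectic manifold $S$ with Poisson tensor $\Lambda$, a first integral is a function $f$ with $\{f,H\}=0$. For a Lie algebra $\mathcal{F}$ (under the Poisson bracket) of first integrals let $F_x=\{df_x:f\in\mathcal{F}\}\subset T^*_xS$, and assume that $\dim F_x$ and $\dim\ker(\Lambda_x|_{F_x})$ are constant on an open dense subset; these constants are $\mathrm{ddim}\,\mathcal{F}$ and $\mathrm{dind}\,\mathcal{F}$. $\mathcal{F}$ is complete if $\mathrm{ddim}\,\mathcal{F}+\mathrm{dind}\,\mathcal{F}=\dim S$. The system is integrable in the non-commutative sense if it possesses a complete algebra of first integrals, and in the commutative (Liouville) sense if it possesses a complete commutative one, i.e. $\mathrm{ddim}\,\mathcal{F}=\mathrm{dind}\,\mathcal{F}=\frac12\dim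 S$. *)

(* Defs.v *)
From HB Require Import structures.
From mathcomp Require Import all_boot all_order all_algebra.
From mathcomp Require Import all_classical all_reals all_analysis.

Set Implicit Arguments.
Unset Strict Implicit.
Unset Printing Implicit Defensive.

Import Order.TTheory GRing.Theory Num.Theory.
Import numFieldNormedType.Exports.

Local Open Scope classical_set_scope.
Local Open Scope ring_scope.

(** * Calculus on R^N *)

Definition partial (R : realType) (N : nat) (i : 'I_N) (f : 'rV[R]_N -> R) :
    'rV[R]_N -> R :=
  fun p => 'D_(delta_mx 0 i) f p.

Definition gradient (R : realType) (N : nat) (f : 'rV[R]_N -> R)
    (p : 'rV[R]_N) : 'rV[R]_N :=
  \row_i partial i f p.

(* C^infinity: all iterated partial derivatives are differentiable (hence
   also continuous). *)
Definition smooth (R : realType) (N : nat) (f : 'rV[R]_N -> R) : Prop :=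
  forall (s : seq 'I_N) (p : 'rV[R]_N),
    differentiable (foldr (@partial R N) f s) p.

(* Lebesgue-null subsets of R^N: for every e > 0 the set is covered by
   countably many boxes of total volume at most e. *)
Definition lebesgue_null (R : realType) (N : nat) (A : set 'rV[R]_N) : Prop :=
  forall e : R, 0 < e ->
  exists a b : nat -> 'rV[R]_N,
    [/\ forall k i, a k 0 i <= b k 0 i,
        A `<=` \bigcup_k [set p | forall i, a k 0 i <= p 0 i <= b k 0 i]
      & (\sum_(0 <= k <oo) (\prod_i (b k 0 i - a k 0 i))%:E <= e%:E)%E].

(* The set V is an r-dimensional linear subspace of R^N: the rows of B form
   a basis of V. *)
Definition has_dim (R : realType) (N : nat) (V : set 'rV[R]_N) (r : nat) :
    Prop :=
  exists B : 'M[R]_(r, N), row_free B /\ V = [set v | (v <= B)%MS].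

(** * The canonical symplectic space T^*R^d = R^(d + d)

   A point is the row vector (q, lambda) of the positions and of the canonically
   conjugate momenta; a covector is written in the basis dq_i, dlambda_i, so
   that the differential of f at p is [gradient f p]. *)

Definition poisson_tensor (R : realType) (d : nat) (a b : 'rV[R]_(d + d)) : R :=
  \sum_(i < d) (a 0 (lshift d i) * b 0 (rshift d i)
                - a 0 (rshift d i) * b 0 (lshift d i)).

Definition poisson (R : realType) (d : nat) (f h : 'rV[R]_(d + d) -> R) :
    'rV[R]_(d + d) -> R :=
  fun p => poisson_tensor (gradient f p) (gradient h p).

Definition first_integral (R : realType) (d : nat)
    (H f : 'rV[R]_(d + d) -> R) : Prop :=
  smooth f /\ forall p, poisson f H p = 0.

Definition lie_algebra (R : realType) (d : nat)
    (F : set ('rV[R]_(d + d) -> R)) : Prop :=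
  [/\ forall f, F f -> smooth f,
      F (fun=> 0),
      forall (a : R) f g, F f -> F g -> F (fun p => a * f p + g p)
    & forall f g, F f -> F g -> F (poisson f g)].

Definition lie_generated (R : realType) (d : nat)
    (G : set ('rV[R]_(d + d) -> R)) : set ('rV[R]_(d + d) -> R) :=
  smallest (@lie_algebra R d) G.

Definition commutative_set (R : realType) (d : nat)
    (F : set ('rV[R]_(d + d) -> R)) : Prop :=
  forall f g, F f -> F g -> forall p, poisson f g p = 0.

Definition differentials (R : realType) (d : nat)
    (F : set ('rV[R]_(d + d) -> R)) (p : 'rV[R]_(d + d)) :
    set 'rV[R]_(d + d) :=
  [set gradient f p | f in F].

Definition tensor_kernel (R : realType) (d : nat)
    (V : set 'rV[R]_(d + d)) : set 'rV[R]_(d + d) :=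
  [set a | V a /\ forall b, V b -> poisson_tensor a b = 0].

Definition ddim_dind (R : realType) (d : nat)
    (F : set ('rV[R]_(d + d) -> R)) (r s : nat) : Prop :=
  exists U : set 'rV[R]_(d + d),
    [/\ open U, dense U
      & forall p, U p -> has_dim (differentials F p) r
                      /\ has_dim (tensor_kernel (differentials F p)) s].

(* F is a complete algebra of first integrals of the Hamiltonian system of H,
   with ddim F = r and dind F = s. *)
Definition complete_algebra (R : realType) (d : nat) (H : 'rV[R]_(d + d) -> R)
    (F : set ('rV[R]_(d + d) -> R)) (r s : nat) : Prop :=
  [/\ lie_algebra F,
      forall f, F f -> first_integral H f,
      ddim_dind F r s
    & (r + s = d + d)%N].

Definition noncommutatively_integrable (R : realType) (d : nat)
    (H : 'rV[R]_(d + d) -> R) : Prop :=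
  exists (F : set ('rV[R]_(d + d) -> R)) (r s : nat),
    complete_algebra H F r s.

Definition liouville_integrable (R : realType) (d : nat)
    (H : 'rV[R]_(d + d) -> R) : Prop :=
  exists F : set ('rV[R]_(d + d) -> R),
    commutative_set F /\ complete_algebra H F d d.

(* f is homogeneous of degree m in the momenta and not identically zero: its
   monomials are indexed by the (ordered) m-tuples of momenta. *)
Definition momentum_degree (R : realType) (d m : nat)
    (f : 'rV[R]_(d + d) -> R) : Prop :=
  (exists p, f p != 0) /\
  exists c : {ffun 'I_m -> 'I_d} -> 'rV[R]_d -> R,
    forall p, f p = \sum_(t : {ffun 'I_m -> 'I_d})
                      c t (lsubmx p) * \prod_(k < m) rsubmx p 0 (t k).

(** * Sub-Riemannian metrics on R^d *)

(* Gram matrix at q of the frame X_0, ..., X_(m-1) for the metric g. *)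
Definition gram (R : realType) (d m : nat)
    (g : 'rV[R]_d -> 'rV[R]_d -> 'rV[R]_d -> R)
    (X : 'I_m -> 'rV[R]_d -> 'rV[R]_d) (q : 'rV[R]_d) : 'M[R]_m :=
  \matrix_(a, b) g q (X a q) (X b q).

Definition pairing (R : realType) (d : nat) (l v : 'rV[R]_d) : R :=
  \sum_i l 0 i * v 0 i.

(* The normal geodesic flow is the Hamiltonian flow of this function. *)
Definition normal_hamiltonian (R : realType) (d m : nat)
    (g : 'rV[R]_d -> 'rV[R]_d -> 'rV[R]_d -> R)
    (X : 'I_m -> 'rV[R]_d -> 'rV[R]_d) (p : 'rV[R]_(d + d)) : R :=
  let q := lsubmx p in let l := rsubmx p in
  2^-1 * \sum_a \sum_b invmx (gram g X q) a b
                       * pairing l (X a q) * pairing l (X b q).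

(** * The Heisenberg group H_(2n+1) = R^(2n+1)

   The group law is (x,y,z)(x',y',z') = (x + x', y + y', z + z' + <x,y'>).
   Coordinates are numbered from 1, in the order x_1..x_n, y_1..y_n, z. *)

Definition coord (R : realType) (n : nat) (v : 'rV[R]_(n + n).+1) (i : nat) :
    R :=
  v 0 (inord i.-1).

Definition basis_vec (R : realType) (n i : nat) : 'rV[R]_(n + n).+1 :=
  delta_mx 0 (inord i.-1).

(* dz - sum_k x_k dy_k *)
Definition contact_form (R : realType) (n : nat) (q v : 'rV[R]_(n + n).+1) :
    R :=
  coord v (2 * n + 1) - \sum_(1 <= k < n.+1) coord q k * coord v (n + k).

Definition heis_metric (R : realType) (n : nat) (q v w : 'rV[R]_(n + n).+1) :
    R :=
  \sum_(1 <= k < n.+1) (coord v k * coord w k + coord v (n + k) * coord w (n + k))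
  + contact_form q v * contact_form q w.

(* The frame d/dx_k + y_k d/dz, d/dy_k (k = 1..n) of D_R; the index a starts
   from 0, so that the first n vectors correspond to k = a + 1. *)
Definition right_frame (R : realType) (n : nat) (a : 'I_(n + n))
    (q : 'rV[R]_(n + n).+1) : 'rV[R]_(n + n).+1 :=
  if (a < n)%N
  then basis_vec R n a.+1 + coord q (n + a.+1) *: basis_vec R n (2 * n + 1)
  else basis_vec R n a.+1.

Notation phase R n := 'rV[R]_((n + n).+1 + (n + n).+1).

Definition xc (R : realType) (n : nat) (p : phase R n) (k : nat) : R :=
  coord (lsubmx p) k.
Definition yc (R : realType) (n : nat) (p : phase R n) (k : nat) : R :=
  coord (lsubmx p) (n + k).
Definition lam (R : realType) (n : nat) (p : phase R n) (i : nat) : R :=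
  coord (rsubmx p) i.

Definition dot (R : realType) (m : nat) (u v : 'cV[R]_m) : R :=
  \sum_i u i 0 * v i 0.

Definition Jmx (R : realType) (n : nat) : 'M[R]_(n + n) :=
  block_mx 0 (- 1%:M) 1%:M 0.

Definition heis_hamiltonian (R : realType) (n : nat) (p : phase R n) : R :=
  let q : 'cV[R]_(n + n) :=
    col_mx (\col_(k < n) xc p k.+1) (\col_(k < n) yc p k.+1) in
  let u : 'cV[R]_(n + n) := col_mx (\col_(k < n) yc p k.+1) 0 in
  let lb : 'cV[R]_(n + n) := \col_(i < n + n) lam p i.+1 in
  let lz := lam p (2 * n + 1) in
  let Jq := Jmx R n *m q in
  2^-1 *
  ((lb^T *m (1%:M - (1 + dot q q)^-1 *: (Jq *m Jq^T)) *m lb) 0 0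
   + 2 * lz * (lb^T *m (u + (dot u u / (1 + dot q q)) *: Jq)) 0 0
   + lz ^+ 2 * (dot u u - dot u u ^+ 2 / (1 + dot q q))).

Definition Pf (R : realType) (n k : nat) (p : phase R n) : R :=
  yc p k.+1 * lam p 1 - xc p 1 * lam p (n + k + 1)
  + xc p k.+1 * lam p (n + 1) - yc p 1 * lam p k.+1.

Definition Qf (R : realType) (n k : nat) (p : phase R n) : R :=
  xc p 1 * lam p k.+1 - xc p k.+1 * lam p 1
  - yc p 1 * lam p (n + k + 1) + yc p k.+1 * lam p (n + 1)
  + (xc p 1 * yc p k.+1 - xc p k.+1 * yc p 1) * lam p (2 * n + 1).

Definition Rf (R : realType) (n j : nat) (p : phase R n) : R :=
  xc p 2 * lam p j.+1 - xc p j.+1 * lam p 2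
  + yc p 2 * lam p (n + j + 1) - yc p j.+1 * lam p (n + 2).

Definition Sf (R : realType) (n j : nat) (p : phase R n) : R :=
  xc p 2 * lam p (n + j + 1) + xc p j.+1 * lam p (n + 2)
  - yc p 2 * lam p j.+1 - yc p j.+1 * lam p 2
  + (xc p 2 * xc p j.+1 - yc p 2 * yc p j.+1) * lam p (2 * n + 1).

(* I_0, ..., I_(2n), followed by I_(2n+l) for l = 1..n-2. *)
Definition heis_integral (R : realType) (n i : nat) : phase R n -> R :=
  if i == 0 then @heis_hamiltonian R n
  else if (i <= n)%N then
    fun p => xc p i * lam p (n + i) - yc p i * lam p i
             + 2^-1 * (xc p i ^+ 2 - yc p i ^+ 2) * lam p (2 * n + 1)
  else if (i < 2 * n)%N then
    fun p => Pf (i - n) p ^+ 2 + Qf (i - n) p ^+ 2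
  else if i == (2 * n)%N then
    fun p => lam p (2 * n + 1)
  else
    let l := (i - 2 * n)%N in
    poisson (fun p => Pf 1 p ^+ 2 + Qf 1 p ^+ 2)
            (fun p => Pf l.+1 p ^+ 2 + Qf l.+1 p ^+ 2).

(* The subtraction is truncated: there is no I_(2n+l) when n <= 2. *)
Definition nb_integrals (n : nat) : nat := (2 * n + 1 + (n - 2))%N.

Definition heis_integrals (R : realType) (n : nat) : set (phase R n -> R) :=
  [set @heis_integral R n i | i in [set i | (i < nb_integrals n)%N]].

(* Main.v *)
Require Import Defs.
From HB Require Import structures.
From mathcomp Require Import all_boot all_order all_algebra.
From mathcomp Require Import all_classical all_reals all_analysis.
From mathcomp Require Import perm ring lra zify.

(** Write u_k = lambda_k + y_k lambda_(2n+1) / 2 and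
    v_k = lambda_(n+k) + x_k lambda_(2n+1) / 2. Then x, y, u, v are canonical
    coordinates commuting with lambda_(2n+1), and H depends only on
    lambda_(2n+1) and on the sums of u_k^2 + v_k^2, of x_k^2 + y_k^2 and of
    x_k v_k - y_k u_k. With z_k = x_k + i y_k and w_k = u_k + i v_k these sums
    are invariant under the unitary group, the I_j are the rotations of the n
    planes, and Q_k - i P_k is the minor z_1 w_(k+1) - z_(k+1) w_1. The minor is
    multiplied by a phase under the rotations, so its squared modulus I_(n+k)
    commutes with H and with all I_j. By the Jacobi identity the same holds for
    the brackets I_(2n+l).

    Completeness. Let K = |p|^2 |q|^2 - <q, p>^2 be the Casimir function of
    so(2n), with p = (u, v). The n + 3 functions H, I_1, ..., I_n, lambda_(2n+1)
    and K commute with each other and with all the integrals, hence with the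
    whole Lie algebra that the integrals generate. Since
    (3n - 1) + (n + 3) = 4n + 2, linear algebra shows that wherever both
    families have independent differentials, the differentials of the generated
    algebra form the skew-orthogonal complement of those of the n + 3 functions,
    and the kernel of the Poisson tensor on it is spanned by the latter
    (lie_generated_rank, complete_algebra_criterion). For n <= 2 the integrals
    commute, and their own family takes the part of the n + 3 functions.

    Independence. All functions are rational without poles. A maximal minor of
    the matrix of differentials that is nonzero at one point is nonzero outside
    a null set with open dense complement: the zero set of a nonzero polynomial
    is covered by graphs of Lipschitz functions (lebesgue_null_graph), and a
    polynomial vanishing on an open set is zero (degree_lt_open). So a single
    point suffices, for instance x_1 = 1, lambda_1 = ... = lambda_n = 1 and all
    other coordinates 0. There the differentials are independent because
    brackets with well-chosen test functions form a triangular system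
    (integrals_independent, center_independent). *)

Set Implicit Arguments.
Unset Strict Implicit.
Unset Printing Implicit Defensive.

Import Order.TTheory GRing.Theory Num.Theory.
Import numFieldNormedType.Exports.

Local Open Scope classical_set_scope.
Local Open Scope ring_scope.

(** * Partial derivatives *)

Section PartialDerivatives.
Variables (R : realType) (N : nat).
Implicit Types (f g : 'rV[R]_N -> R) (p v : 'rV[R]_N) (i j : 'I_N).

Lemma partialE f p i : differentiable f p ->
  partial i f p = 'd f p (delta_mx 0 i).
Proof. by move=> df; rewrite /partial deriveE. Qed.

Lemma diff_partial f p v : differentiable f p ->
  'd f p v = \sum_i v 0 i * partial i f p.
Proof.
move=> df; rewrite {1}(row_sum_delta v) linear_sum /=; apply: eq_bigr => i _.
by rewrite linearZ partialE.
Qed.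

Lemma partial_cst i (c : R) : partial i (cst c : 'rV[R]_N -> R) = 0.
Proof. by apply/funext => p; rewrite /partial derive_cst. Qed.

Lemma partial0 i : partial i (0 : 'rV[R]_N -> R) = 0.
Proof. exact: (partial_cst i 0). Qed.

Lemma partial_coord i j :
  partial i (fun p : 'rV[R]_N => p 0 j) = cst (j == i)%:R.
Proof.
apply/funext => p.
have /matrixP/(_ 0 j) := derive_mx (@derivable_id _ _ p (delta_mx 0 i : 'rV[R]_N)).
by rewrite /partial derive_id !mxE /= => <-.
Qed.

Lemma partialD i f g : (forall p, differentiable f p) ->
  (forall p, differentiable g p) ->
  partial i (f + g) = partial i f + partial i g.
Proof.
by move=> df dg; apply/funext => p; rewrite /partial deriveD //; apply: diff_derivable.
Qed.

Lemma partialM i f g : (forall p, differentiable f p) ->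
  (forall p, differentiable g p) ->
  partial i (f * g) = f * partial i g + g * partial i f.
Proof.
by move=> df dg; apply/funext => p; rewrite /partial deriveM //; apply: diff_derivable.
Qed.

Lemma partialV i f : (forall p, f p != 0) -> (forall p, differentiable f p) ->
  partial i (fun p => (f p)^-1) =
  - partial i f * (fun p => (f p)^-1) * (fun p => (f p)^-1).
Proof.
move=> f0 df; apply/funext => p; rewrite /partial deriveV //; last exact: diff_derivable.
rewrite -exprVn expr2; set a := (f p)^-1; set b := derive f p _.
transitivity (- b * a * a) => //; rewrite /GRing.scale /=; ring.
Qed.

(** The one-variable theorem for the restriction of f to the segment from a to
    b, whose derivative is expanded along the coordinate directions. *)
Lemma mean_value f (a b : 'rV[R]_N) : (forall p, differentiable f p) ->
  exists2 t, t \in `[0, 1] & f b - f a =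
    \sum_i (b - a) 0 i * partial i f (a + t *: (b - a)).
Proof.
move=> df; set v : 'rV[R]_N := b - a; set phi := fun t : R => a + t *: v.
have d (t : R) : is_derive t 1 (f \o phi) (\sum_i v 0 i * partial i f (phi t)).
  (* both difference quotients are the same function of the increment *)
  have E : (fun h : R => h^-1 *: ((f \o phi \o shift t) (h *: 1) - (f \o phi) t)) =
           (fun h : R => h^-1 *: ((f \o shift (phi t)) (h *: v) - f (phi t))).
    apply/funext => h /=; congr (_ *: (f _ - _)).
    by rewrite /phi scalerDl scaler1 addrCA addrA.
  have dv : derivable f (phi t) v := diff_derivable (df (phi t)).
  have <- : 'D_v f (phi t) = \sum_i v 0 i * partial i f (phi t).
    exact: etrans (deriveE _ (df (phi t))) (diff_partial _ (df (phi t))).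
  by apply: DeriveDef; [move: dv; rewrite /derivable -E | rewrite /derive E].
have [t t01 e] : exists2 t, t \in `[0, 1] & (f \o phi) 1 - (f \o phi) 0 =
    (\sum_i v 0 i * partial i f (phi t)) * (1 - 0).
  apply: (@MVT_segment R (f \o phi)) => // s.
  - apply: continuous_subspaceT => s'; apply: differentiable_continuous.
    by apply: differentiable_comp.
exists t => //; move: e; rewrite /= /phi scale1r scale0r addr0 subr0 mulr1.
by rewrite /v subrKC.
Qed.

Lemma partial0_constant f : (forall p, differentiable f p) ->
  (forall i, partial i f = 0) -> forall p q, f p = f q.
Proof.
move=> df f0 p q; have [t _ /eqP] := mean_value q p df.
by rewrite big1 => [|i _]; rewrite ?f0 ?mulr0 // subr_eq0 => /eqP.
Qed.

End PartialDerivatives.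

(** * Rational functions without poles *)

Section RationalFunctions.
Variables (R : realType) (N : nat).

(** All functions considered below belong to this class. It is stable under
    partial derivatives, so its members are smooth, and they inherit from
    polynomials the smallness of their zero sets. *)
Inductive rational_fun : ('rV[R]_N -> R) -> Prop :=
| rational_cst c : rational_fun (cst c)
| rational_coord i : rational_fun (fun p => p 0 i)
| rationalD f g : rational_fun f -> rational_fun g -> rational_fun (f + g)
| rationalM f g : rational_fun f -> rational_fun g -> rational_fun (f * g)
| rationalV f : (forall p, f p != 0) -> rational_fun f ->
    rational_fun (fun p => (f p)^-1).

Inductive poly_fun : ('rV[R]_N -> R) -> Prop :=
| poly_cst c : poly_fun (cst c)
| poly_coord i : poly_fun (fun p => p 0 i)
| polyD f g : poly_fun f -> poly_fun g -> poly_fun (f + g)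
| polyM f g : poly_fun f -> poly_fun g -> poly_fun (f * g).

Implicit Types (f g : 'rV[R]_N -> R).

Lemma rational_differentiable f p : rational_fun f -> differentiable f p.
Proof.
move=> rf; elim: rf p => {f} [c|i|f g _ df _ dg|f g _ df _ dg|f f0 _ df] p.
- exact: differentiable_cst.
- exact: differentiable_coord.
- exact: differentiableD.
- exact: differentiableM.
- exact: differentiableV.
Qed.

Lemma rationalN f : rational_fun f -> rational_fun (- f).
Proof.
have -> : - f = cst (-1) * f by apply/funext => p /=; rewrite /GRing.mul /= mulN1r.
by apply: rationalM; exact: rational_cst.
Qed.

Lemma rationalB f g : rational_fun f -> rational_fun g -> rational_fun (f - g).
Proof. by move=> rf rg; apply: rationalD => //; exact: rationalN. Qed.

Lemma rational0 : rational_fun 0. Proof. exact: (rational_cst 0). Qed.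
Lemma rational1 : rational_fun 1. Proof. exact: (rational_cst 1). Qed.

Lemma rational_sum (I : Type) (r : seq I) (P : pred I) (F : I -> 'rV[R]_N -> R) :
  (forall i, rational_fun (F i)) -> rational_fun (\sum_(i <- r | P i) F i).
Proof.
move=> h; elim/big_ind : _ => //; [exact: rational0|exact: rationalD].
Qed.

Lemma rational_prod (I : Type) (r : seq I) (P : pred I) (F : I -> 'rV[R]_N -> R) :
  (forall i, rational_fun (F i)) -> rational_fun (\prod_(i <- r | P i) F i).
Proof.
move=> h; elim/big_ind : _ => //; [exact: rational1|exact: rationalM].
Qed.

Lemma rational_partial i f : rational_fun f -> rational_fun (partial i f).
Proof.
elim => {f} [c|j|f g rf pf rg pg|f g rf pf rg pg|f f0 rf pf].
- by rewrite partial_cst; exact: rational0.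
- by rewrite partial_coord; exact: rational_cst.
- by rewrite partialD; [exact: rationalD| |] => p; exact: rational_differentiable.
- rewrite partialM; [|by move=> p; exact: rational_differentiable..].
  by apply: rationalD; exact: rationalM.
- rewrite partialV //; last by move=> p; exact: rational_differentiable.
  by do 2?[apply: rationalM; last exact: rationalV]; exact: rationalN.
Qed.

Lemma rational_smooth f : rational_fun f -> smooth f.
Proof.
move=> rf s p; apply: rational_differentiable.
by elim: s => //= i s; exact: rational_partial.
Qed.

(** By induction on the construction of f: for an inverse, the second
    derivatives are symmetric because those of f are. *)
Lemma rational_partialC i j f : rational_fun f ->
  partial i (partial j f) = partial j (partial i f).
Proof.
have dif := rational_differentiable; have pr := rational_partial.
elim => {f} [c|k|f g rf pf rg pg|f g rf pf rg pg|f f0 rf pf].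
- by rewrite !partial_cst ?partial0.
- by rewrite !partial_coord !partial_cst.
- by rewrite !partialD; [rewrite pf pg|move=> p; apply: dif; auto..].
- rewrite !partialM; [|move=> p; apply: dif; auto..].
  rewrite !partialD; [|move=> p; apply: dif; auto using rationalM..].
  rewrite !partialM; [|move=> p; apply: dif; auto..].
  rewrite pf pg; move: (partial j (partial i f)) (partial j (partial i g)) => a b.
  move: (partial i f) (partial j f) (partial i g) (partial j g) => c d x y.
  by clear; ring.
- have rV := rationalV f0 rf.
  have pV l := partialV l f0 (fun p => dif _ p rf).
  move: (fun p => (f p)^-1) rV pV => g rg pg; rewrite !pg.
  have pN l h : rational_fun h -> partial l (- h) = - partial l h.
    move=> rh; have -> : - h = cst (-1) * h.
      by apply/funext => p /=; rewrite /GRing.mul /= mulN1r.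
    rewrite partialM; [|move=> p; apply: dif; auto using rational_cst..].
    by rewrite partial_cst mulr0 addr0; apply/funext => p; rewrite /GRing.mul /= mulN1r.
  rewrite !partialM; [|move=> p; apply: dif; auto using rationalM, rationalN..].
  rewrite !pN; [|auto..].
  rewrite !pg pf; move: (partial j (partial i f)) => a.
  by move: (partial i f) (partial j f) => c d; clear; ring.
Qed.

Lemma poly_rational f : poly_fun f -> rational_fun f.
Proof. by elim=> *; [exact: rational_cst|exact: rational_coord|exact: rationalD|exact: rationalM]. Qed.

(** Reduces the study of zeros of rational functions to that of polynomials;
    the denominators never vanish, so an inverse just exchanges numerator and
    denominator. *)
Lemma rational_quotient f : rational_fun f -> exists g h,
  [/\ poly_fun g, poly_fun h, forall p, h p != 0 & forall p, f p = g p / h p].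
Proof.
elim => {f} [c|i|f g _ [a [b [pa pb b0 fE]]] _ [c [d [pc pd d0 gE]]]
            |f g _ [a [b [pa pb b0 fE]]] _ [c [d [pc pd d0 gE]]]
            |f f0 _ [a [b [pa pb b0 fE]]]].
- exists (cst c), (cst 1); split; try exact: poly_cst; move=> p /=.
    exact: oner_neq0.
  by rewrite divr1.
- exists (fun p => p 0 i), (cst 1); split; try exact: poly_cst; try exact: poly_coord; move=> p /=.
    exact: oner_neq0.
  by rewrite divr1.
- exists (a * d + c * b), (b * d); split.
  + by apply: polyD; exact: polyM.
  + exact: polyM.
  + by move=> p; rewrite mulf_neq0.
  + move=> p; rewrite /GRing.add /GRing.mul /= fE gE addf_div //.
- exists (a * c), (b * d); split; try exact: polyM.
  + by move=> p; rewrite mulf_neq0.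
  + by move=> p; rewrite /GRing.mul /= fE gE mulf_div.
- exists b, a; split => // p; last by rewrite fE invf_div.
  by apply: contraNneq (f0 p); rewrite fE => ->; rewrite mul0r.
Qed.

(** The bound deg f < k, read off from the vanishing of all derivatives of
    order k. *)
Fixpoint degree_lt (k : nat) f : Prop :=
  if k is k'.+1 then forall i, degree_lt k' (partial i f) else f = 0.

Lemma degree_lt0 k : degree_lt k 0.
Proof. by elim: k => //= k IH i; rewrite partial0. Qed.

Lemma degree_ltS k f : degree_lt k f -> degree_lt k.+1 f.
Proof.
elim: k f => [f -> i|k IH f h i]; first by rewrite partial0.
exact/IH/h.
Qed.

Lemma degree_lt_mono k l f : (k <= l)%N -> degree_lt k f -> degree_lt l f.
Proof.
move=> /subnKC <-; elim: (l - k)%N => [|m IH]; rewrite ?addn0 // addnS.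
by move=> /IH; exact: degree_ltS.
Qed.

Lemma degree_ltD k f g : rational_fun f -> rational_fun g ->
  degree_lt k f -> degree_lt k g -> degree_lt k (f + g).
Proof.
elim: k f g => [f g _ _ -> ->|k IH f g rf rg hf hg i]; first by rewrite /= addr0.
rewrite partialD; [|by move=> p; exact: rational_differentiable..].
by apply: IH; try exact: rational_partial.
Qed.

Lemma degree_ltM k l f g : rational_fun f -> rational_fun g ->
  degree_lt k f -> degree_lt l g -> degree_lt (k + l) (f * g).
Proof.
elim: k l f g => [l f g _ _ -> _|k IHk l f g rf rg hf].
  by rewrite mul0r; exact: degree_lt0.
elim: l g rg => [|l IHl] g rg hg; first by rewrite [g]hg mulr0; exact: degree_lt0.
move=> i; rewrite partialM; [|by move=> p; exact: rational_differentiable..].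
have rp := rational_partial.
apply: degree_ltD; try by apply: rationalM => //; exact: rp.
- by rewrite -/(degree_lt _ _) -addSnnS; apply: IHl => //; exact: rp.
- by rewrite mulrC; apply: IHk => //; exact: rp.
Qed.

Lemma poly_degree f : poly_fun f -> exists k, degree_lt k f.
Proof.
elim => {f} [c|i|f g pf [k hk] pg [l hl]|f g pf [k hk] pg [l hl]].
- by exists 1%N => i /=; rewrite partial_cst.
- by exists 2%N => j l /=; rewrite partial_coord partial_cst.
- exists (maxn k l); apply: degree_ltD; try exact: poly_rational.
    by apply: degree_lt_mono hk; rewrite leq_maxl.
  by apply: degree_lt_mono hl; rewrite leq_maxr.
- by exists (k + l)%N; apply: degree_ltM => //; exact: poly_rational.
Qed.

(** The derivatives also vanish on U, hence everywhere by induction on the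
    degree; so f is constant. *)
Lemma degree_lt_open k f (U : set 'rV[R]_N) q : rational_fun f ->
  degree_lt k f -> open U -> U q -> (forall p, U p -> f p = 0) -> forall p, f p = 0.
Proof.
elim: k f => [f _ -> //|k IH f rf fk oU Uq fU p].
have p0 i : partial i f = 0.
  apply/funext => x; apply: (IH (partial i f)) => //; first exact: rational_partial.
  move=> y Uy; rewrite /partial.
  have -> : 'D_(delta_mx 0 i) f y = 'D_(delta_mx 0 i) (cst 0) y.
    case: (eqVneq (delta_mx 0 i : 'rV[R]_N) 0) => [->|e0].
      by rewrite !derive0.
    apply: near_eq_derive => //; apply: filterS (open_nbhs_nbhs (conj oU Uy)) => z.
    exact: fU.
  by rewrite derive_cst.
rewrite (partial0_constant _ p0 p q) ?fU // => x; exact: rational_differentiable.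
Qed.

End RationalFunctions.

(** * Lebesgue-null sets *)

Section NullSets.
Variables (R : realType) (N : nat).
Implicit Types (A B : set 'rV[R]_N).

Lemma lebesgue_null_sub A B : A `<=` B -> lebesgue_null B -> lebesgue_null A.
Proof.
move=> AB nB e e0; have [a [b [ab cov sum]]] := nB e e0.
by exists a, b; split => //; exact: subset_trans cov.
Qed.

(** The k-th set is covered with total volume e / 2 ^ (k + 1), and a bijection
    of the natural numbers with their pairs enumerates the boxes of all these
    coverings. *)
Lemma lebesgue_null_bigcup (F : nat -> set 'rV[R]_N) :
  (forall k, lebesgue_null (F k)) -> lebesgue_null (\bigcup_k F k).
Proof.
move=> nF e e0.
have /choice[ab abP] : forall k, exists ab : (nat -> 'rV[R]_N) * (nat -> 'rV[R]_N),
    [/\ forall m i, ab.1 m 0 i <= ab.2 m 0 i,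
        F k `<=` \bigcup_m [set p | forall i, ab.1 m 0 i <= p 0 i <= ab.2 m 0 i]
      & (\sum_(0 <= m <oo) (\prod_i (ab.2 m 0 i - ab.1 m 0 i))%:E
         <= (e / (2 ^ k.+1)%:R)%:E)%E].
  move=> k; have ek : 0 < e / (2 ^ k.+1)%:R by rewrite divr_gt0 // ltr0n expn_gt0.
  by have [a [b h]] := nF k _ ek; exists (a, b).
have /ppcard_eqP[f] : ([set: nat] #= [set: nat * nat])%card.
  by rewrite card_eq_sym; exact: card_nat2.
pose vol k m := (\prod_i ((ab k).2 m 0 i - (ab k).1 m 0 i))%:E : \bar R.
have vol0 k m : (0 <= vol k m)%E.
  rewrite lee_fin; apply: prodr_ge0 => i _; rewrite subr_ge0.
  by have [+ _ _] := abP k; exact.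
exists (fun l => (ab (f l).1).1 (f l).2), (fun l => (ab (f l).1).2 (f l).2); split.
- by move=> l i; have [+ _ _] := abP (f l).1; exact.
- move=> p [k _ Fp]; have [_ /(_ p Fp)[m _ /= pm] _] := abP k.
  have [l _ flE] : exists2 l, True & f l = (k, m).
    have := @surj _ _ _ _ f; rewrite /set_surj => /(_ (k, m) I)[l _ <-].
    by exists l.
  by exists l => //= i; rewrite flE /=; exact: pm.
- rewrite -/(vol _ _).
  apply: le_trans (epsilon_trick0 xpredT (ltW e0)).
  have -> : (\sum_(0 <= l <oo) vol (f l).1 (f l).2 = \sum_(k <oo) \sum_(m <oo) vol k m)%E.
    rewrite [RHS]nneseries_esumT; last by move=> k; exact: nneseries_ge0.
    rewrite nneseries_esumT //.
    under [in RHS]eq_esum do rewrite nneseries_esumT //.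
    rewrite (@esum_esum _ _ _ _ _ (fun k m => vol k m)) //.
    rewrite [RHS](reindex_esum [set: nat] _ f)//; last first.
    have := @bijTT _ _ f.
    rewrite -setTT_bijective/=; congr (set_bij _ _ _).
    by apply/seteqP; split.
  apply: lee_nneseries => // [k _ _|k _]; first exact: nneseries_ge0.
  by have [_ _] := abP k.
Qed.

Hypothesis N_gt0 : (0 < N)%N.

(** A finite covering is completed to a sequence by boxes reduced to the
    origin, whose volume is 0 because N > 0. *)
Lemma lebesgue_null_finite_cover A :
  (forall e : R, 0 < e -> exists (T : finType) (a b : T -> 'rV[R]_N),
    [/\ forall t i, a t 0 i <= b t 0 i,
        forall p, A p -> exists t, forall i, a t 0 i <= p 0 i <= b t 0 i
      & \sum_t \prod_i (b t 0 i - a t 0 i) <= e]) -> lebesgue_null A.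
Proof.
move=> h e /h[T [a [b [ab cov vol]]]].
pose ext (c : T -> 'rV[R]_N) k := oapp (fun k => c (enum_val k)) 0 (insub k : option 'I_#|T|).
have ext_ord c (k : 'I_#|T|) : ext c k = c (enum_val k) by rewrite /ext valK.
have ext_big c k : (#|T| <= k)%N -> ext c k = 0.
  by move=> Tk; rewrite /ext insubF //= ltnNge Tk.
exists (ext a), (ext b); split.
- by move=> k i; rewrite /ext; case: insub => [k'|] //=.
- move=> p /cov[t tp]; exists (enum_rank t) => //=.
  by rewrite !ext_ord enum_rankK.
- have vol0 k : (0 <= (\prod_i (ext b k 0 i - ext a k 0 i))%:E)%E.
    rewrite lee_fin; apply: prodr_ge0 => i _; rewrite subr_ge0 /ext.
    by case: insub => [k'|] /=.
  rewrite (nneseries_split 0 #|T|) // eseries0 ?adde0; last first.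
    move=> k; rewrite add0n => Tk _; rewrite !ext_big //.
    by rewrite (bigD1 (Ordinal N_gt0)) //= subrr mul0r.
  rewrite add0n sumEFin lee_fin big_mkord; apply: le_trans vol.
  rewrite (reindex_onto (fun t : T => enum_rank t) enum_val) /=; last first.
    by move=> k _; rewrite enum_valK.
  rewrite (eq_bigl xpredT); last by move=> t; rewrite enum_rankK eqxx.
  by apply: ler_sum => t _; rewrite !ext_ord enum_rankK.
Qed.

Lemma lebesgue_null0 : lebesgue_null (set0 : set 'rV[R]_N).
Proof.
apply: lebesgue_null_finite_cover => e e0.
by exists void, (fun=> 0), (fun=> 0); split => //; rewrite big1 ?ltW // => -[].
Qed.

(** Each point lies in a ball of radius 1 / (m + 1) with rational centre that
    is contained in the ball given for this point, and there are only
    countably many such balls. *)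
Lemma lebesgue_null_locally A :
  (forall p, A p -> exists2 r : R, 0 < r & lebesgue_null (A `&` ball p r)) ->
  lebesgue_null A.
Proof.
move=> loc.
pose Q (c : 'rV[rat]_N * nat) := ball (map_mx ratr c.1 : 'rV[R]_N) (c.2.+1%:R^-1).
pose F k := if unpickle k is Some c then
  if `[< lebesgue_null (A `&` Q c) >] then A `&` Q c else set0 else set0.
apply: (@lebesgue_null_sub _ (\bigcup_k F k)); last first.
  apply: lebesgue_null_bigcup => k; rewrite /F.
  case: unpickle => [c|]; last exact: lebesgue_null0.
  by case: asboolP => // _; exact: lebesgue_null0.
move=> p Ap; have [r r0 nr] := loc p Ap.
have [m mr] : exists m, m.+1%:R^-1 < r / 2.
  have := @archi_boundP R (r / 2)^-1; rewrite invr_ge0 divr_ge0 ?ltW // => /(_ isT) h.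
  exists (Num.bound (r / 2)^-1); rewrite -[ltRHS]invrK ltf_pV2 ?posrE ?invr_gt0 ?divr_gt0 //.
  by apply: lt_trans h _; rewrite ltr_nat.
have m0 : 0 < m.+1%:R^-1 :> R by rewrite invr_gt0.
have /choice[c cP] : forall j, exists q : rat, `|ratr q - p 0 j| < m.+1%:R^-1.
  move=> j; have /rat_in_itvoo[q] : p 0 j - m.+1%:R^-1 < p 0 j + m.+1%:R^-1.
    by rewrite ltrD2l; apply: lt_trans m0; rewrite oppr_lt0.
  by rewrite inE /= => qP; exists q; rewrite ltr_distl.
exists (pickle (\row_j c j : 'rV[rat]_N, m)) => //; rewrite /F pickleK.
have Qp : Q (\row_j c j, m) p.
  by split=> // i j; rewrite ord1 !mxE; exact: cP.
rewrite ifT; first by split.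
apply/asboolP; apply: lebesgue_null_sub nr => q [Aq [_ Qq]]; split => //.
split => // i j; have [_ /(_ i j) Qpj] := Qp; have Qqj := Qq i j.
rewrite (splitr r).
apply: (@ball_triangle _ _ ((map_mx ratr (\row_j c j) : 'rV[R]_N) i j)).
  by apply: ball_sym; apply: le_ball Qpj => /=; exact: ltW.
by apply: le_ball Qqj => /=; exact: ltW.
Qed.

End NullSets.

(** * Zero sets of rational functions *)

Section ZeroSets.
Variables (R : realType) (N : nat).
Hypothesis N_gt0 : (0 < N)%N.

Lemma grid_index (M : nat) (h x : R) : 0 < h -> 0 <= x < M.+1%:R * h ->
  exists k : 'I_M.+1, k%:R * h <= x <= k%:R * h + h.
Proof.
move=> h0 /andP[x0]; elim: M => [|M IH] xM.
  by exists ord0; rewrite mul0r add0r x0 /=; apply: ltW; rewrite mul1r in xM.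
case: (ltP x (M.+1%:R * h)) => [/IH[k kP]|Mx].
  by exists (widen_ord (leqnSn _) k).
exists ord_max; rewrite Mx /=; move: xM; rewrite -[in X in X -> _]natr1 mulrDl mul1r.
exact: ltW.
Qed.

(** Near such a point the zero set is a Lipschitz graph over the coordinates
    other than i: if two zeros differ by at most h in those coordinates, the
    mean value theorem bounds their distance in the coordinate i by L * h. A
    grid of step h = 2 r / M in the other coordinates therefore yields M ^ (N
    - 1) boxes of total volume proportional to h. *)
Lemma lebesgue_null_graph (f : 'rV[R]_N -> R) (i : 'I_N) : rational_fun f ->
  lebesgue_null [set p | f p = 0 /\ partial i f p != 0].
Proof.
move=> rf; have df p := rational_differentiable p rf.
apply: lebesgue_null_locally => // p0 [_ fi0].
have cont j : {for p0, continuous (partial j f)}.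
  by apply: differentiable_continuous; apply: rational_differentiable; exact: rational_partial.
set c := `|partial i f p0| / 2.
have c0 : 0 < c by rewrite divr_gt0 // normr_gt0.
set C := \sum_j `|partial j f p0| + 1.
have C0 : 0 < C by rewrite ltr_wpDl // sumr_ge0.
have [r r0 rP] : exists2 r : R, 0 < r & forall p, ball p0 r p ->
    c <= `|partial i f p| /\ forall j, `|partial j f p| <= C.
  have : \forall p \near p0, c <= `|partial i f p| /\ forall j, `|partial j f p| <= C.
    have hc : \forall p \near p0, c <= `|partial i f p|.
      have /cvgrPdist_lt/(_ _ c0) := cont i; apply: filterS => p pc.
      have := ler_distD 0 (partial i f p0) (partial i f p).
      have := ler_normB (partial i f p0 - partial i f p) (- partial i f p).
      rewrite opprK subrK normrN => h _; rewrite -(lerD2r c) -[c in X in X <= _ + _](mul1r) /c.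
      rewrite mul1r -splitr; apply: le_trans h _; rewrite addrC lerD2l; exact: ltW.
    have hC : \forall p \near p0, forall j, `|partial j f p| <= C.
      suff hj j : \forall p \near p0, `|partial j f p| <= C.
        exact: (@filter_forall _ _ (fun j p => `|partial j f p| <= C) _ _ hj).
      have /cvgrPdist_lt/(_ 1 ltr01) := cont j; apply: filterS => p pc.
      have := ler_normB (partial j f p0) (partial j f p0 - partial j f p).
      rewrite opprB addrC subrK => /le_trans; apply; apply: lerD; last exact: ltW.
      by rewrite (bigD1 j) //= lerDl sumr_ge0.
    by apply: filterS2 hc hC.
  by move=> /nbhs_ballP[r r0 rP]; exists r => // p /rP.
exists r => //; apply: lebesgue_null_finite_cover => // e e0.
pose L := N%:R * C / c.
have L0 : 0 <= L by rewrite divr_ge0 ?mulr_ge0 // ltW.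
pose W := \prod_(j | j != i) (2 * r).
have W0 : 0 <= W by apply: prodr_ge0 => j _; rewrite mulr_ge0 // ltW.
pose K := 2 * L * (2 * r) * W.
have r20 : 0 <= 2 * r by apply: mulr_ge0 => //; exact: ltW.
have K0 : 0 <= K by do 3?apply: mulr_ge0 => //.
pose M := Num.bound (K / e); pose h := 2 * r / M.+1%:R.
have h0 : 0 < h by rewrite divr_gt0 // mulr_gt0.
have Mh : M.+1%:R * h = 2 * r by rewrite mulrC divfK // pnatr_eq0.
have Ke : 2 * L * h * W <= e.
  have -> : 2 * L * h * W = K / M.+1%:R by rewrite /K /h; ring.
  rewrite ler_pdivrMr // mulrC -ler_pdivrMr //.
  apply: le_trans (ltW (archi_boundP (divr_ge0 K0 (ltW e0)))) _.
  by rewrite ler_nat.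
pose A := [set p | f p = 0] `&` ball p0 r.
pose lo (t : {ffun 'I_N -> 'I_M.+1}) j : R := p0 0 j - r + (t j)%:R * h.
pose col t (p : 'rV[R]_N) := forall j, j != i -> lo t j <= p 0 j <= lo t j + h.
(* a zero in the column over the cell t, if there is one *)
pose z t := xget p0 [set p | A p /\ col t p].
(* The index t i does not select a cell: the boxes with t i != 0 are degenerate,
   which makes the total volume a product of sums over the coordinates. *)
pose a (t : {ffun 'I_N -> 'I_M.+1}) : 'rV[R]_N := \row_j (if j == i then if t i == ord0 then z t 0 i - L * h else 0 else lo t j).
pose b (t : {ffun 'I_N -> 'I_M.+1}) : 'rV[R]_N := \row_j (if j == i then if t i == ord0 then z t 0 i + L * h else 0 else lo t j + h).
exists {ffun 'I_N -> 'I_M.+1}, a, b; split.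
- move=> t j; rewrite !mxE; case: eqP => _; last by rewrite lerDl ltW.
  case: ifP => // _; rewrite lerD2l; apply: (@le_trans _ _ 0).
    by rewrite oppr_le0 mulr_ge0 // ltW.
  by rewrite mulr_ge0 // ltW.
- move=> p [[fp _] pr].
  have /choice[k kP] : forall j, exists k : 'I_M.+1,
      p0 0 j - r + k%:R * h <= p 0 j <= p0 0 j - r + k%:R * h + h.
    move=> j; have [|k] := @grid_index M h (p 0 j - (p0 0 j - r)) h0.
      have [_ /(_ 0 j)] := pr; rewrite Mh /ball /= ltr_distl; lra.
    by exists k; lra.
  pose t := [ffun j => if j == i then ord0 else k j].
  have tp : col t p by move=> j ji; rewrite /lo ffunE (negPf ji); exact: kP.
  have [[fz zr] zc] : [set p | A p /\ col t p] (z t).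
    by apply: (@xgetPex _ p0 [set p | A p /\ col t p]); exists p.
  exists t => j; rewrite !mxE; case: eqP => [->|/eqP ji]; last exact: tp.
  rewrite ffunE eqxx /= -ler_distlC distrC.
  have [s /itvP s01] := mean_value (z t) p df.
  rewrite fp fz subrr => /eqP; rewrite eq_sym (bigD1 i) //= addr_eq0 => /eqP e1.
  have [ci Cj] : c <= `|partial i f (z t + s *: (p - z t))| /\
      forall j, `|partial j f (z t + s *: (p - z t))| <= C.
    apply: rP; split=> // i' j'; rewrite ord1 !mxE /ball /=.
    have [_ /(_ 0 j')] := pr; have [_ /(_ 0 j')] := zr; rewrite /ball /= !ltr_distl.
    move: (z t 0 j') (p 0 j') (p0 0 j') => zz pp qq.
    have s0 : 0 <= s by rewrite s01.
    have s1 : s <= 1 by rewrite s01.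
    have conv x y : 0 < x -> 0 < y -> 0 < x + s * (y - x).
      move=> x0 y0; case: (leP x y) => xy.
        by apply: ltr_wpDr => //; apply: mulr_ge0; rewrite // subr_ge0.
      nra.
    move=> /andP[h1 h2] /andP[h3 h4]; apply/andP; split.
      have := conv (qq - zz + r) (qq - pp + r); lra.
    have := conv (zz + r - qq) (pp + r - qq); lra.
  have e2 : `|p 0 i - z t 0 i| * c <= N%:R * (h * C).
    apply: (@le_trans _ _ `|(p - z t) 0 i * partial i f (z t + s *: (p - z t))|).
      by rewrite normrM !mxE ler_wpM2l.
    rewrite e1 normrN; apply: le_trans (ler_norm_sum _ _ _) _.
    apply: (@le_trans _ _ (\sum_(j < N) h * C)); last by rewrite sumr_const card_ord mulr_natl.
    rewrite [leRHS](bigD1 i) //=; apply: ler_wpDl; first by apply: mulr_ge0; exact: ltW.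
    apply: ler_sum => l li; rewrite normrM; apply: ler_pM => //.
    rewrite !mxE ler_norml; have := zc l li; have := tp l li; lra.
  have -> : L * h = N%:R * (h * C) / c by rewrite /L; ring.
  by rewrite ler_pdivlMr.
- pose s (j : 'I_N) (k : 'I_M.+1) : R :=
    if j == i then if k == ord0 then 2 * L * h else 0 else h.
  have -> : \sum_t \prod_j (b t 0 j - a t 0 j) =
      \sum_(t : {ffun 'I_N -> 'I_M.+1}) \prod_j s j (t j).
    apply: eq_bigr => t _; apply: eq_bigr => j _; rewrite !mxE /s.
    case: eqP => [->|_]; last by ring.
    by case: ifP => _; ring.
  rewrite -(bigA_distr_bigA s) (bigD1 i) //=.
  have -> : \sum_k s i k = 2 * L * h.
    by rewrite big_ord_recl /s !eqxx big1 ?addr0 // => k _; rewrite /= eqxx.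
  have -> : \prod_(j | j != i) \sum_k s j k = W.
    apply: eq_bigr => j ji; rewrite /s (negPf ji) sumr_const card_ord.
    by rewrite -[LHS]mulr_natl Mh.
  exact: Ke.
Qed.

(** If some derivative of f is not identically zero, a zero of f is either a
    zero of this derivative, to which induction on the degree applies, or one
    of the points treated by lebesgue_null_graph. Otherwise f is a nonzero
    constant. *)
Lemma lebesgue_null_degree_lt k (f : 'rV[R]_N -> R) q : rational_fun f ->
  degree_lt k f -> f q != 0 -> lebesgue_null [set p | f p = 0].
Proof.
elim: k f q => [f q _ -> /eqP//|k IH f q rf fk fq].
have [[i [x fx]]|nx] := pselect (exists i x, partial i f x != 0).
  have nU (A B : set 'rV[R]_N) : lebesgue_null A -> lebesgue_null B ->
      lebesgue_null (A `|` B).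
    move=> nA nB; rewrite -bigcup2E; apply: lebesgue_null_bigcup => -[|[|m]] //=.
    exact: lebesgue_null0.
  apply: lebesgue_null_sub (nU _ _ (lebesgue_null_graph i rf)
                                   (IH _ x (rational_partial i rf) (fk i) fx)).
  by move=> p fp; case: (eqVneq (partial i f p) 0) => h; [right|left].
suff -> : [set p | f p = 0] = set0 by exact: lebesgue_null0.
apply/seteqP; split => // p fp; move: fq; rewrite -fp => /negP; apply.
apply/eqP/partial0_constant => [x|i].
  exact: rational_differentiable.
by apply/funext => x; apply/eqP/negP => /negP fx; apply: nx; exists i, x.
Qed.

Lemma rational_zeros_null (f : 'rV[R]_N -> R) q : rational_fun f -> f q != 0 ->
  lebesgue_null [set p | f p = 0].
Proof.
move=> /rational_quotient[g [h [pg ph h0 fE]]]; rewrite fE => gq.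
have [k gk] := poly_degree pg.
apply: lebesgue_null_sub (lebesgue_null_degree_lt (poly_rational pg) gk (q := q) _).
  move=> p /= /eqP; rewrite fE mulf_eq0 invr_eq0 (negPf (h0 p)) orbF => /eqP //.
by apply: contraNneq gq => ->; rewrite mul0r.
Qed.

Lemma rational_nonzeros_open_dense (f : 'rV[R]_N -> R) q : rational_fun f ->
  f q != 0 -> open [set p | f p != 0] /\ dense [set p | f p != 0].
Proof.
move=> rf fq; split.
  have -> : [set p | f p != 0] = f @^-1` [set x | x != 0] by [].
  apply: open_comp; last exact: open_neq.
  by move=> p _; apply: differentiable_continuous; exact: rational_differentiable.
move=> U [x Ux] oU; apply: contrapT => nU.
have /rational_quotient[g [h [pg ph h0 fE]]] := rf.
have [k gk] := poly_degree pg.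
have g0 p : g p = 0.
  apply: degree_lt_open (poly_rational pg) gk oU Ux _ p => y Uy.
  apply/eqP/negP => /negP gy; apply: nU; exists y; split => //=.
  by rewrite fE mulf_neq0 // invr_eq0.
by move: fq; rewrite fE g0 mul0r eqxx.
Qed.

End ZeroSets.

(** * The Poisson bracket of rational functions *)

Section PointwiseOperations.
Variables (R : realType) (T : Type).
Implicit Types (f g : T -> R).

Lemma funDE f g x : (f + g) x = f x + g x. Proof. by []. Qed.
Lemma funME f g x : (f * g) x = f x * g x. Proof. by []. Qed.
Lemma funNE f x : (- f) x = - f x. Proof. by []. Qed.

Definition funE := (funDE, funME, funNE).

End PointwiseOperations.

Section PoissonAlgebra.
Variables (R : realType) (d : nat).
Implicit Types (f g h : 'rV[R]_(d + d) -> R) (a b : 'rV[R]_(d + d)).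

Lemma poissonE f g : poisson f g = fun p =>
  \sum_(i < d) (partial (lshift d i) f p * partial (rshift d i) g p
                - partial (rshift d i) f p * partial (lshift d i) g p).
Proof.
by apply/funext => p; apply: eq_bigr => i _; rewrite !mxE.
Qed.

Lemma rational_poisson f g : rational_fun f -> rational_fun g ->
  rational_fun (poisson f g).
Proof.
move=> rf rg; rewrite poissonE.
have -> : (fun p => \sum_(i < d) (partial (lshift d i) f p * partial (rshift d i) g p
                - partial (rshift d i) f p * partial (lshift d i) g p)) =
   \sum_(i < d) (partial (lshift d i) f * partial (rshift d i) g
                - partial (rshift d i) f * partial (lshift d i) g).
  by apply/funext => p; rewrite fct_sumE.
apply: rational_sum => i; apply: rationalB; apply: rationalM; exact: rational_partial.
Qed.

Lemma poissonC f g : poisson f g = - poisson g f.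
Proof.
apply/funext => p; rewrite funNE !poissonE -sumrN; apply: eq_bigr => i _.
by rewrite opprB; congr (_ - _); exact: mulrC.
Qed.

Lemma poissonff f : poisson f f = 0.
Proof.
by apply/funext => p; rewrite poissonE big1 // => i _; rewrite mulrC subrr.
Qed.

Lemma poissonDl f g h : rational_fun f -> rational_fun g ->
  poisson (f + g) h = poisson f h + poisson g h.
Proof.
move=> rf rg; have df p := rational_differentiable p rf.
have dg p := rational_differentiable p rg.
apply/funext => p; rewrite funDE !poissonE -big_split /=; apply: eq_bigr => i _.
rewrite !partialD // !funE.
move: (partial _ f p) (partial _ g p) (partial _ h p) (partial _ f p) (partial _ g p) (partial _ h p).
by clear; move=> *; ring.
Qed.

Lemma poissonMl f g h : rational_fun f -> rational_fun g ->
  poisson (f * g) h = f * poisson g h + g * poisson f h.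
Proof.
move=> rf rg; have df p := rational_differentiable p rf.
have dg p := rational_differentiable p rg.
apply/funext => p; rewrite !funE !poissonE !mulr_sumr -big_split /=.
apply: eq_bigr => i _; rewrite !partialM // !funE.
move: (partial _ f p) (partial _ g p) (partial _ h p) (partial _ f p) (partial _ g p) (partial _ h p).
by clear; move=> *; ring.
Qed.

Lemma poisson_cstl (c : R) h : poisson (cst c) h = 0.
Proof.
by apply/funext => p; rewrite poissonE big1 // => i _; rewrite !partial_cst !mul0r subrr.
Qed.

Lemma poisson0l h : poisson 0 h = 0. Proof. exact: (poisson_cstl 0). Qed.
Lemma poisson0r h : poisson h 0 = 0. Proof. by rewrite poissonC poisson0l oppr0. Qed.

Lemma partial_poisson k f g p : rational_fun f -> rational_fun g ->
  partial k (poisson f g) p = \sum_(j < d)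
    (partial k (partial (lshift d j) f) p * partial (rshift d j) g p
     + partial (lshift d j) f p * partial k (partial (rshift d j) g) p
     - partial k (partial (rshift d j) f) p * partial (lshift d j) g p
     - partial (rshift d j) f p * partial k (partial (lshift d j) g) p).
Proof.
move=> rf rg; have rp i F : rational_fun F -> rational_fun (partial i F) by exact: rational_partial.
have -> : poisson f g =
   \sum_(i < d) (partial (lshift d i) f * partial (rshift d i) g
                - partial (rshift d i) f * partial (lshift d i) g).
  by rewrite poissonE; apply/funext => q; rewrite fct_sumE.
have dif F : rational_fun F -> forall q, differentiable F q.
  by move=> rF q; exact: rational_differentiable.
have -> : partial k (\sum_(i < d) (partial (lshift d i) f * partial (rshift d i) g
                - partial (rshift d i) f * partial (lshift d i) g)) =
  \sum_(i < d) partial k (partial (lshift d i) f * partial (rshift d i) g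
                - partial (rshift d i) f * partial (lshift d i) g).
  elim: (index_enum _) => [|i r IH]; first by rewrite !big_nil partial0.
  rewrite !big_cons partialD ?IH //; apply: dif.
    by apply: rationalB; apply: rationalM; auto.
  by apply: rational_sum => j; apply: rationalB; apply: rationalM; auto.
rewrite fct_sumE; apply: eq_bigr => j _.
have -> : partial (lshift d j) f * partial (rshift d j) g
    - partial (rshift d j) f * partial (lshift d j) g =
   partial (lshift d j) f * partial (rshift d j) g
    + cst (-1) * (partial (rshift d j) f * partial (lshift d j) g).
  by congr (_ + _); apply/funext => q; rewrite /GRing.mul /GRing.opp /= mulN1r.
have pD F G : rational_fun F -> rational_fun G ->
    partial k (F + G) p = partial k F p + partial k G p.
  by move=> rF rG; rewrite partialD //; exact: dif.
have pM F G : rational_fun F -> rational_fun G ->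
    partial k (F * G) p = F p * partial k G p + G p * partial k F p.
  by move=> rF rG; rewrite partialM //; exact: dif.
rewrite pD; [|auto using rationalM, rational_cst..].
rewrite !pM; [|auto using rationalM, rational_cst..].
rewrite partial_cst mulr0 addr0 /cst.
move: (partial k (partial (lshift d j) f) p) (partial k (partial (rshift d j) f) p).
move: (partial k (partial (lshift d j) g) p) (partial k (partial (rshift d j) g) p).
move: (partial (lshift d j) f p) (partial (rshift d j) f p).
move: (partial (lshift d j) g p) (partial (rshift d j) g p).
clear; move=> *; ring.
Qed.

(** After expansion, the difference of the two sides is a sum over pairs (i,
    j) of canonical pairs of coordinates. By the symmetry of second
    derivatives its terms change sign when i and j are exchanged, so the sum
    is its own opposite. *)
Lemma jacobi f g h : rational_fun f -> rational_fun g -> rational_fun h ->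
  poisson f (poisson g h) = poisson (poisson f g) h + poisson g (poisson f h).
Proof.
move=> rf rg rh; apply/funext => p.
pose l (i : 'I_d) : 'I_(d + d) := lshift d i.
pose r (i : 'I_d) : 'I_(d + d) := rshift d i.
pose x1 (F G H : 'rV[R]_(d + d) -> R) i j := partial (l i) F p *
   (partial (r i) (partial (l j) G) p * partial (r j) H p
     + partial (l j) G p * partial (r i) (partial (r j) H) p
     - partial (r i) (partial (r j) G) p * partial (l j) H p
     - partial (r j) G p * partial (r i) (partial (l j) H) p)
  - partial (r i) F p *
   (partial (l i) (partial (l j) G) p * partial (r j) H p
     + partial (l j) G p * partial (l i) (partial (r j) H) p
     - partial (l i) (partial (r j) G) p * partial (l j) H p
     - partial (r j) G p * partial (l i) (partial (l j) H) p).
have E F G H : rational_fun F -> rational_fun G -> rational_fun H ->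
    poisson F (poisson G H) p = \sum_i \sum_j x1 F G H i j.
  move=> rF rG rH; rewrite [in LHS]poissonE; apply: eq_bigr => i _.
  rewrite !partial_poisson // !mulr_sumr -sumrB; apply: eq_bigr => j _ //.
rewrite (poissonC (poisson f g)) !funE !E //.
apply/eqP; rewrite addrC -subr_eq opprK -subr_eq0.
set S := (X in X == 0); suff : S = - S by move=> h0; apply/eqP; lra.
pose t i j := x1 f g h i j + x1 h f g i j - x1 g f h i j.
have SE : S = \sum_i \sum_j t i j.
  rewrite /S -big_split -sumrB; apply: eq_bigr => i _.
  by rewrite -big_split -sumrB.
rewrite {1}SE exchange_big SE -sumrN; apply: eq_bigr => i _; rewrite -sumrN.
apply: eq_bigr => j _; rewrite /t /x1.
have C k m F : rational_fun F -> partial k (partial m F) p = partial m (partial k F) p.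
  by move=> rF; rewrite (rational_partialC k m rF).
clear t SE S E x1.
move: (@partial R (d + d)) (l i) (l j) (r i) (r j) C => P li lj ri rj C.
rewrite !(C lj li) // !(C rj ri) // !(C rj li) // !(C ri lj) //.
move: (P li (P lj f) p) (P li (P rj f) p) (P lj (P ri f) p) (P ri (P rj f) p).
move: (P li (P lj g) p) (P li (P rj g) p) (P lj (P ri g) p) (P ri (P rj g) p).
move: (P li (P lj h) p) (P li (P rj h) p) (P lj (P ri h) p) (P ri (P rj h) p).
move: (P li f p) (P ri f p) (P lj f p) (P rj f p).
move: (P li g p) (P ri g p) (P lj g p) (P rj g p).
move: (P li h p) (P ri h p) (P lj h p) (P rj h p).
clear; move=> *; ring.
Qed.

End PoissonAlgebra.

(** * A criterion for completeness *)

Section Completeness.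
Variables (R : realType) (d : nat).
Implicit Types (f g h : 'rV[R]_(d + d) -> R) (F G : set ('rV[R]_(d + d) -> R)).

(** Only rational functions are admitted: they form a Poisson algebra, whereas
    the Jacobi identity may fail for functions whose second derivatives are
    not symmetric. *)
Definition commutant G := [set f | rational_fun f /\ forall g, G g -> poisson f g = 0].

Lemma commutant_lie_algebra G : (forall g, G g -> rational_fun g) ->
  lie_algebra (commutant G).
Proof.
move=> rG; split.
- by move=> f [rf _]; exact: rational_smooth.
- by split=> [|g _]; [exact: rational0 | exact: poisson0l].
- move=> c f g [rf fG] [rg gG].
  have -> : (fun p => c * f p + g p) = cst c * f + g by [].
  have rc := @rational_cst R (d + d) c.
  have rcf := rationalM rc rf.
  split=> [|h Gh]; first exact: rationalD.
  by rewrite poissonDl // poissonMl // poisson_cstl fG // gG // !mulr0 !addr0.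
- move=> f g [rf fG] [rg gG]; split=> [|h Gh]; first exact: rational_poisson.
  rewrite poissonC jacobi //; last exact: rG.
  by rewrite (poissonC h f) (poissonC h g) fG // gG // oppr0 poisson0l poisson0r addr0 oppr0.
Qed.

Lemma lie_generated_sub F G : lie_algebra G -> F `<=` G -> lie_generated F `<=` G.
Proof. by move=> lG FG; exact: smallest_sub. Qed.

Lemma sub_lie_generated F : F `<=` lie_generated F.
Proof. exact: sub_smallest. Qed.

Lemma lie_generated_lie_algebra F G : lie_algebra G -> F `<=` G ->
  lie_algebra (lie_generated F).
Proof.
move=> lG FG; split.
- by move=> f /(lie_generated_sub lG FG) Gf; have [+ _ _ _] := lG; exact.
- by move=> A [[_ A0 _ _] _].
- move=> c f g Ff Fg A [lA FA]; have [_ _ + _] := lA; apply; first exact: Ff.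
  exact: Fg.
- move=> f g Ff Fg A [lA FA]; have [_ _ _ +] := lA; apply; first exact: Ff.
  exact: Fg.
Qed.

(** The generated algebra lies in the commutant of F, and also in the
    commutant of that commutant, which is a Lie algebra containing F. *)
Lemma lie_generated_commutative F : (forall f, F f -> rational_fun f) ->
  (forall f g, F f -> F g -> poisson f g = 0) -> commutative_set (lie_generated F).
Proof.
move=> rF cF.
have l1 := commutant_lie_algebra rF.
have s1 : lie_generated F `<=` commutant F.
  by apply: lie_generated_sub => // f Ff; split=> [|g Fg]; [exact: rF | exact: cF].
have l2 : lie_algebra (commutant (commutant F)).
  by apply: commutant_lie_algebra => f [].
have s2 : lie_generated F `<=` commutant (commutant F).
  apply: lie_generated_sub => // f Ff; split=> [|g [rg gF]]; first exact: rF.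
  by rewrite poissonC gF // oppr0.
by move=> f g /s2[_ fc] /s1 gc p; rewrite fc.
Qed.

Definition omega : 'M[R]_(d + d) := block_mx 0 1%:M (- 1%:M) 0.

Lemma poisson_tensorE a b : poisson_tensor a b = (a *m omega *m b^T) 0 0.
Proof.
rewrite -{2}(hsubmxK a) -{2}(hsubmxK b) tr_row_mx mul_row_block mul_row_col.
rewrite !mulmx0 add0r addr0 mulmx1 mulmxN mulmx1 !mxE -big_split /=.
apply: eq_bigr => i _; rewrite !mxE; ring.
Qed.

Lemma omega_unit : omega \in unitmx.
Proof.
suff /mulmx1_unit[] : omega *m (- omega) = 1%:M by [].
rewrite mulmxN mulmx_block !mul0mx !mulmx0 !add0r !addr0 !mulmx1 mul1mx.
by rewrite opp_block_mx !opprK !oppr0 -scalar_mx_block.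
Qed.

Definition gradient_mx m (f : 'I_m -> 'rV[R]_(d + d) -> R) p : 'M[R]_(m, d + d) :=
  \matrix_i gradient (f i) p.

(** As omega is invertible, the skew-orthogonal complement of the rows of B
    has dimension d + d - s = r; it contains the rows of A, which already span
    r dimensions. *)
Lemma symplectic_orthogonal r s (A : 'M[R]_(r, d + d)) (B : 'M[R]_(s, d + d)) :
  row_free A -> row_free B -> (r + s = d + d)%N -> A *m omega *m B^T = 0 ->
  forall a : 'rV[R]_(d + d), (a <= A)%MS = (a *m omega *m B^T == 0).
Proof.
move=> fA fB rs AB a.
have rk : \rank (kermx (omega *m B^T)) = r.
  rewrite mxrank_ker -mxrank_tr trmx_mul trmxK mxrankMfree ?(eqP fB) ?[d + d]rs; last first.
    by rewrite row_free_unit unitmx_tr omega_unit.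
  by rewrite -rs addnK.
have sub : (A <= kermx (omega *m B^T))%MS by apply/sub_kermxP; rewrite mulmxA.
have /eqmxP e : (A == kermx (omega *m B^T))%MS.
  by rewrite -(geq_leqif (mxrank_leqif_eq sub)) rk (eqP fA).
by rewrite e -mulmxA; apply/sub_kermxP/eqP.
Qed.

Lemma gradient_mx_tensor r s (f : 'I_r -> 'rV[R]_(d + d) -> R)
    (g : 'I_s -> 'rV[R]_(d + d) -> R) p :
  (forall i j, poisson (f i) (g j) = 0) ->
  gradient_mx f p *m omega *m (gradient_mx g p)^T = 0.
Proof.
move=> fg; apply/matrixP => i j.
have -> : (gradient_mx f p *m omega *m (gradient_mx g p)^T) i j =
    (row i (gradient_mx f p) *m omega *m (row j (gradient_mx g p))^T) 0 0.
  rewrite -row_mul [LHS]mxE [RHS]mxE; apply: eq_bigr => k _.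
  by rewrite !mxE.
by rewrite -poisson_tensorE !rowK -/(poisson _ _ p) fg mxE.
Qed.

Lemma gradient_lin (c : R) f g p : rational_fun f -> rational_fun g ->
  gradient (fun p => c * f p + g p) p = c *: gradient f p + gradient g p.
Proof.
move=> rf rg; have rc := @rational_cst R (d + d) c.
have -> : (fun p => c * f p + g p) = cst c * f + g by [].
have dif h : rational_fun h -> forall q, differentiable h q.
  by move=> rh q; exact: rational_differentiable.
apply/rowP => i; rewrite !mxE partialD; [|apply: dif; auto using rationalM..].
rewrite partialM; [|apply: dif; auto..].
by rewrite partial_cst mulr0 addr0.
Qed.

Lemma gradient0 p : gradient (fun=> 0 : R) p = 0 :> 'rV[R]_(d + d).
Proof. by apply/rowP => i; rewrite !mxE partial_cst. Qed.

Lemma lie_algebra_combination F m (f : 'I_m -> 'rV[R]_(d + d) -> R) (c : 'I_m -> R) p :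
  lie_algebra F -> (forall i, F (f i)) -> (forall f, F f -> rational_fun f) ->
  exists2 h, F h & gradient h p = \sum_i c i *: gradient (f i) p.
Proof.
move=> [_ F0 FL _] Ff Fr; elim: (index_enum _) => [|i r [h Fh hE]].
  by exists (fun=> 0) => //; rewrite big_nil gradient0.
exists (fun p => c i * f i p + h p); first exact: FL.
by rewrite big_cons gradient_lin ?hE //; exact: Fr.
Qed.

(** Let V be the span of the differentials of the g j at p. The differentials
    of F lie in the skew-orthogonal complement of V, which has dimension r and
    is spanned by those of the f i. As the g j commute, V is contained in its
    complement, so the kernel of the Poisson tensor on the complement is V
    itself. *)
Lemma lie_generated_rank F r s (f : 'I_r -> 'rV[R]_(d + d) -> R)
    (g : 'I_s -> 'rV[R]_(d + d) -> R) p :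
  lie_algebra F -> (forall i, F (f i)) ->
  (forall h, F h -> rational_fun h /\ forall j, poisson h (g j) = 0) ->
  (forall i j, poisson (g i) (g j) = 0) -> (r + s = d + d)%N ->
  row_free (gradient_mx f p) -> row_free (gradient_mx g p) ->
  has_dim (differentials F p) r /\ has_dim (tensor_kernel (differentials F p)) s.
Proof.
move=> lF Ff Fg gg rs jf jg.
have fg i j : poisson (f i) (g j) = 0 by have [_] := Fg _ (Ff i); exact.
have gf i j : poisson (g i) (f j) = 0 by rewrite poissonC fg oppr0.
have fP := symplectic_orthogonal jf jg rs (gradient_mx_tensor p fg).
have sr : (s + r = d + d)%N by rewrite addnC.
have gP := symplectic_orthogonal jg jf sr (gradient_mx_tensor p gf).
have dE : differentials F p = [set v | (v <= gradient_mx f p)%MS].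
  apply/seteqP; split => [_ [h Fh <-]|v /= /submxP[c ->]].
    have [rh hg] := Fg h Fh; rewrite /= fP.
    have := @gradient_mx_tensor 1 s (fun=> h) g p (fun _ => hg).
    by rewrite (_ : gradient_mx (fun=> h) p = gradient h p) => [->//|]; apply/row_matrixP => i; rewrite ord1 rowK row_id.
  have Fr h : F h -> rational_fun h by move=> /Fg[].
  have [h Fh hE] := lie_algebra_combination (fun i => c 0 i) p lF Ff Fr.
  exists h => //; rewrite hE mulmx_sum_row; apply: eq_bigr => i _.
  by rewrite rowK.
rewrite dE; split; first by exists (gradient_mx f p).
exists (gradient_mx g p); split => //; apply/seteqP; split => [a [/= af aT]|a /= ag].
  rewrite /= gP; apply/eqP/rowP => i; rewrite [RHS]mxE.
  rewrite -(aT (row i (gradient_mx f p))); last exact: row_sub.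
  rewrite poisson_tensorE [LHS]mxE [RHS]mxE; apply: eq_bigr => k _.
  by rewrite !mxE.
split=> [|b /= /submxP[c ->]].
  rewrite /= fP; have /submxP[c ->] := ag.
  by rewrite -!mulmxA (mulmxA _ omega) (gradient_mx_tensor p gg) mulmx0.
move: ag; rewrite gP => /eqP ag.
by rewrite poisson_tensorE trmx_mul mulmxA ag mul0mx mxE.
Qed.

(** If B is a right inverse of the matrix of differentials at q, the
    determinant of the product of this matrix with B at a variable point p is
    a rational function of p with value 1 at q. *)
Lemma rational_gradient_rank m (f : 'I_m -> 'rV[R]_(d + d) -> R) q :
  (forall i, rational_fun (f i)) -> row_free (gradient_mx f q) ->
  exists D, [/\ rational_fun D, D q != 0 & forall p, D p != 0 -> row_free (gradient_mx f p)].
Proof.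
move=> rf /row_freeP[B fB].
exists (fun p => \det (gradient_mx f p *m B)); split.
- have -> : (fun p => \det (gradient_mx f p *m B)) =
      \sum_(s : 'S_m) cst ((-1) ^+ s) * \prod_i \sum_k partial k (f i) * cst (B k (s i)).
    apply/funext => p; rewrite fct_sumE; apply: eq_bigr => s _; rewrite funME; congr (_ * _).
    rewrite fct_prodE; apply: eq_bigr => i _; rewrite fct_sumE mxE.
    by apply: eq_bigr => k _; rewrite !mxE.
  apply: rational_sum => s; apply: rationalM; first exact: rational_cst.
  apply: rational_prod => i; apply: rational_sum => k; apply: rationalM.
    exact: rational_partial.
  exact: rational_cst.
- by rewrite fB det1 oner_neq0.
- move=> p Dp; apply/row_freeP; exists (B *m invmx (gradient_mx f p *m B)).
  by rewrite mulmxA mulmxV // unitmxE unitfE.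
Qed.

Hypothesis d_gt0 : (0 < d)%N.

Lemma dependent_null m (f : 'I_m -> 'rV[R]_(d + d) -> R) q :
  (forall i, rational_fun (f i)) -> row_free (gradient_mx f q) ->
  lebesgue_null [set p | ~~ row_free (gradient_mx f p)].
Proof.
move=> rf /(rational_gradient_rank rf)[D [rD Dq DP]].
have dd : (0 < d + d)%N by rewrite addn_gt0 d_gt0.
apply: lebesgue_null_sub (rational_zeros_null dd rD Dq) => p /= np.
by apply: contraNeq np; exact: DP.
Qed.

(** The algebra generated by F stays in the commutant of the g j, so
    lie_generated_rank applies wherever both families are independent; this
    set is open and dense as soon as it contains one point q. *)
Lemma complete_algebra_criterion H F r s (f : 'I_r -> 'rV[R]_(d + d) -> R)
    (g : 'I_s -> 'rV[R]_(d + d) -> R) q :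
  (r + s = d + d)%N -> F = range f ->
  (forall i, rational_fun (f i)) -> (forall j, rational_fun (g j)) ->
  (forall i j, poisson (f i) (g j) = 0) -> (forall i j, poisson (g i) (g j) = 0) ->
  row_free (gradient_mx f q) -> row_free (gradient_mx g q) -> range g H ->
  complete_algebra H (lie_generated F) r s.
Proof.
move=> rs -> rf rg fg gg jf jg gH.
have rgg h : range g h -> rational_fun h by move=> [j _ <-].
have lG := commutant_lie_algebra rgg.
have FG : range f `<=` commutant (range g).
  by move=> _ [i _ <-]; split => // _ [j _ <-].
have sG := lie_generated_sub lG FG.
have lF := lie_generated_lie_algebra lG FG.
split => //.
- move=> h /sG[rh hg]; split; first exact: rational_smooth.
  by move=> p; rewrite hg.
- have [D [rD Dq DP]] := rational_gradient_rank rf jf.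
  have [E [rE Eq EP]] := rational_gradient_rank rg jg.
  have DE : (D * E) q != 0 by rewrite funME mulf_neq0.
  have dd : (0 < d + d)%N by rewrite addn_gt0 d_gt0.
  have [oU dU] := rational_nonzeros_open_dense (rationalM rD rE) DE.
  exists [set p | (D * E) p != 0]; split => // p /=.
  rewrite funME mulf_eq0 negb_or => /andP[Dp Ep].
  apply: (lie_generated_rank (f := f) (g := g)) => //; auto.
  + by move=> i; apply: sub_lie_generated; exists i.
  + by move=> h /sG[rh hg]; split => // j; apply: hg; exists j.
Qed.

End Completeness.

(** * The ring of rational functions *)

Section RationalRing.
Variables (R : realType) (N : nat).

Definition rational_pred : {pred ('rV[R]_N -> R)} := fun f => `[< rational_fun f >].

Lemma rational_predP f : reflect (rational_fun f) (f \in rational_pred).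
Proof. exact: asboolP. Qed.

Fact rational_subring_closed : subring_closed rational_pred.
Proof.
split=> [|f g|f g]; first by apply/rational_predP; exact: rational1.
- by move=> /rational_predP rf /rational_predP rg; apply/rational_predP; exact: rationalB.
- by move=> /rational_predP rf /rational_predP rg; apply/rational_predP; exact: rationalM.
Qed.

HB.instance Definition _ :=
  GRing.isSubringClosed.Build _ rational_pred rational_subring_closed.

(** With rationality bundled, the Poisson bracket is a biderivation of a
    commutative ring and brackets are computed by ring identities. *)
Record ratfun := RatFun { ratfun_val :> 'rV[R]_N -> R; _ : ratfun_val \in rational_pred }.

HB.instance Definition _ := [isSub for ratfun_val].
HB.instance Definition _ := [Choice of ratfun by <:].
HB.instance Definition _ := [SubChoice_isSubComNzRing of ratfun by <:].

End RationalRing.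

(** * Unitary symmetry in an abstract Poisson ring *)

Record poisson_bracket (A : comNzRingType) (br : A -> A -> A) : Prop := {
  bracketDl : forall f g h, br (f + g) h = br f h + br g h;
  bracketMl : forall f g h, br (f * g) h = f * br g h + g * br f h;
  bracketC : forall f g, br f g = - br g f;
  bracketff : forall f, br f f = 0;
  bracketJ : forall f g h, br f (br g h) = br (br f g) h + br g (br f h) }.

Section PoissonRing.
Variables (A : comNzRingType) (br : A -> A -> A).
Hypothesis P : poisson_bracket br.
Implicit Types f g h : A.

Let brDl := bracketDl P.
Let brMl := bracketMl P.
Let brC := bracketC P.

Lemma br0l f : br 0 f = 0.
Proof. by apply: (addIr (br 0 f)); rewrite -brDl !add0r. Qed.

Lemma brNl f g : br (- f) g = - br f g.
Proof. by apply/eqP; rewrite -addr_eq0 -brDl addNr br0l. Qed.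

Lemma br1l f : br 1 f = 0.
Proof. by apply: (addIr (br 1 f)); rewrite add0r -{3}[1]mulr1 brMl mul1r. Qed.

Lemma brMnl f g k : br (f *+ k) g = br f g *+ k.
Proof. by elim: k => [|k IH]; rewrite ?mulr0n ?br0l // !mulrS brDl IH. Qed.

Lemma br_natl k f : br k%:R f = 0.
Proof. by rewrite brMnl br1l mul0rn. Qed.

Lemma br_suml (I : Type) (r : seq I) (Q : pred I) (F : I -> A) f :
  br (\sum_(i <- r | Q i) F i) f = \sum_(i <- r | Q i) br (F i) f.
Proof.
by elim/big_rec2 : _ => [|i a b _ <-]; [exact: br0l | exact: brDl].
Qed.

Lemma brDr f g h : br f (g + h) = br f g + br f h.
Proof. by rewrite brC brDl opprD -!(brC f). Qed.

Lemma brNr f g : br f (- g) = - br f g.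
Proof. by rewrite brC brNl -brC. Qed.

Lemma brMr f g h : br f (g * h) = g * br f h + h * br f g.
Proof. by rewrite brC brMl opprD -!mulrN -!(brC f). Qed.

Lemma br_natr k f : br f k%:R = 0.
Proof. by rewrite brC br_natl oppr0. Qed.

Lemma br_sumr (I : Type) (r : seq I) (Q : pred I) (F : I -> A) f :
  br f (\sum_(i <- r | Q i) F i) = \sum_(i <- r | Q i) br f (F i).
Proof. by rewrite brC br_suml -sumrN; apply: eq_bigr => i _; rewrite -brC. Qed.

(** The constant 1/2 of the Hamiltonian is characterised inside an abstract
    ring by the equation 2 * c = 1. *)
Lemma br_half c f : 2 * c = 1 -> br c f = 0.
Proof.
move=> c2; have := br1l f; rewrite -c2 brMl br_natl mulr0 addr0 => e.
by rewrite -[LHS]mul1r -c2 mulrAC e mul0r.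
Qed.

Lemma br_inverse f w g : w * f = 1 -> br f g = 0 -> br w g = 0.
Proof.
move=> wf fg; have := br1l g; rewrite -wf brMl fg mulr0 add0r => e.
by rewrite -[LHS]mul1r -wf -mulrA e mulr0.
Qed.

End PoissonRing.

(** z and L are one conjugate pair, and x, y, u and v are canonical
    coordinates on the reduced phase spaces, the level sets of L modulo the
    flow of L. *)
Record darboux_frame (A : comNzRingType) (br : A -> A -> A) (n : nat)
  (x y u v : 'I_n -> A) (z L : A) : Prop := {
  br_xx : forall i j, br (x i) (x j) = 0;
  br_xy : forall i j, br (x i) (y j) = 0;
  br_yy : forall i j, br (y i) (y j) = 0;
  br_uu : forall i j, br (u i) (u j) = 0;
  br_uv : forall i j, br (u i) (v j) = 0;
  br_vv : forall i j, br (v i) (v j) = 0;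
  br_xu : forall i j, br (x i) (u j) = (i == j)%:R;
  br_xv : forall i j, br (x i) (v j) = 0;
  br_yu : forall i j, br (y i) (u j) = 0;
  br_yv : forall i j, br (y i) (v j) = (i == j)%:R;
  br_xL : forall i, br (x i) L = 0;
  br_yL : forall i, br (y i) L = 0;
  br_uL : forall i, br (u i) L = 0;
  br_vL : forall i, br (v i) L = 0;
  br_zL : br z L = 1 }.

Section UnitaryFirstIntegrals.
Variables (A : comNzRingType) (br : A -> A -> A) (n : nat).
Variables (x y u v : 'I_n -> A) (z L : A).
Hypothesis P : poisson_bracket br.
Hypothesis F : darboux_frame br x y u v z L.

Let brDl := bracketDl P.
Let brMl := bracketMl P.
Let brC := bracketC P.

Let yx i j : br (y i) (x j) = 0. Proof. by rewrite brC (br_xy F) oppr0. Qed.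
Let ux i j : br (u i) (x j) = - (i == j)%:R. Proof. by rewrite brC (br_xu F) eq_sym. Qed.
Let vx i j : br (v i) (x j) = 0. Proof. by rewrite brC (br_xv F) oppr0. Qed.
Let uy i j : br (u i) (y j) = 0. Proof. by rewrite brC (br_yu F) oppr0. Qed.
Let vy i j : br (v i) (y j) = - (i == j)%:R. Proof. by rewrite brC (br_yv F) eq_sym. Qed.
Let vu i j : br (v i) (u j) = 0. Proof. by rewrite brC (br_uv F) oppr0. Qed.
Let Lx i : br L (x i) = 0. Proof. by rewrite brC (br_xL F) oppr0. Qed.
Let Ly i : br L (y i) = 0. Proof. by rewrite brC (br_yL F) oppr0. Qed.
Let Lu i : br L (u i) = 0. Proof. by rewrite brC (br_uL F) oppr0. Qed.
Let Lv i : br L (v i) = 0. Proof. by rewrite brC (br_vL F) oppr0. Qed.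
Let atomE := (br_xx F, br_xy F, br_yy F, br_uu F, br_uv F, br_vv F, br_xu F, br_xv F,
  br_yu F, br_yv F, (br_xL F, br_yL F, br_uL F, br_vL F, bracketff P L),
  (yx, ux, vx, uy, vy, vu, Lx, Ly, Lu, Lv)).

Definition kinetic := \sum_k (u k * u k + v k * v k).
Definition radius2 := \sum_k (x k * x k + y k * y k).
Definition rotation := \sum_k (x k * v k - y k * u k).
Definition dilation := \sum_k (x k * u k + y k * v k).

Lemma sum_delta (G : 'I_n -> A) i : \sum_k (i == k)%:R * G k = G i.
Proof.
rewrite (bigD1 i) //= eqxx mul1r big1 ?addr0 // => k.
by rewrite eq_sym => /negPf ->; rewrite mul0r.
Qed.

Lemma br_sum_delta f (H G : 'I_n -> A) i :
  (forall k, br (H k) f = (i == k)%:R * G k) -> br (\sum_k H k) f = G i.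
Proof. by move=> e; rewrite (br_suml P) -sum_delta; apply: eq_bigr. Qed.

Let deltaC (i k : 'I_n) : (k == i)%:R = (i == k)%:R :> A. Proof. by rewrite eq_sym. Qed.

Let simp := (brDl, brNl P, brMl, brDr P, brNr P, brMr P, br_natl P, br_natr P, atomE).

Lemma br_kinetic i :
  (br kinetic (x i) = - 2 * u i) * (br kinetic (y i) = - 2 * v i) *
  (br kinetic (u i) = 0) * (br kinetic (v i) = 0).
Proof.
split; [split; [split|]|].
- by apply: (br_sum_delta (G := fun k => - 2 * u k)) => k; rewrite !simp deltaC; ring.
- by apply: (br_sum_delta (G := fun k => - 2 * v k)) => k; rewrite !simp deltaC; ring.
- by apply: (br_sum_delta (i := i) (G := fun k => 0)) => k; rewrite !simp; ring.
- by apply: (br_sum_delta (i := i) (G := fun k => 0)) => k; rewrite !simp; ring.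
Qed.

Lemma br_radius2 i :
  (br radius2 (x i) = 0) * (br radius2 (y i) = 0) *
  (br radius2 (u i) = 2 * x i) * (br radius2 (v i) = 2 * y i).
Proof.
split; [split; [split|]|].
- by apply: (br_sum_delta (i := i) (G := fun k => 0)) => k; rewrite !simp; ring.
- by apply: (br_sum_delta (i := i) (G := fun k => 0)) => k; rewrite !simp; ring.
- by apply: (br_sum_delta (G := fun k => 2 * x k)) => k; rewrite !simp deltaC; ring.
- by apply: (br_sum_delta (G := fun k => 2 * y k)) => k; rewrite !simp deltaC; ring.
Qed.

Lemma br_rotation i :
  (br rotation (x i) = y i) * (br rotation (y i) = - x i) *
  (br rotation (u i) = v i) * (br rotation (v i) = - u i).
Proof.
split; [split; [split|]|].
- by apply: (br_sum_delta (G := fun k => y k)) => k; rewrite !simp deltaC; ring.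
- by apply: (br_sum_delta (G := fun k => - x k)) => k; rewrite !simp deltaC; ring.
- by apply: (br_sum_delta (G := fun k => v k)) => k; rewrite !simp deltaC; ring.
- by apply: (br_sum_delta (G := fun k => - u k)) => k; rewrite !simp deltaC; ring.
Qed.

Lemma br_dilation i :
  (br dilation (x i) = - x i) * (br dilation (y i) = - y i) *
  (br dilation (u i) = u i) * (br dilation (v i) = v i).
Proof.
split; [split; [split|]|].
- by apply: (br_sum_delta (G := fun k => - x k)) => k; rewrite !simp deltaC; ring.
- by apply: (br_sum_delta (G := fun k => - y k)) => k; rewrite !simp deltaC; ring.
- by apply: (br_sum_delta (G := fun k => u k)) => k; rewrite !simp deltaC; ring.
- by apply: (br_sum_delta (G := fun k => v k)) => k; rewrite !simp deltaC; ring.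
Qed.

Let sums := (br_kinetic, br_radius2, br_rotation, br_dilation).

Lemma br_sum_L : [/\ br kinetic L = 0, br radius2 L = 0, br rotation L = 0
  & br dilation L = 0].
Proof.
by split; rewrite (br_suml P) big1 // => k _; rewrite !simp; ring.
Qed.

(** By this and the next lemmas, radius2, kinetic and dilation span a copy of
    sl_2, with which rotation commutes. *)
Lemma br_radius2_kinetic : br radius2 kinetic = 4 * dilation.
Proof.
rewrite (br_sumr P) /dilation mulr_sumr; apply: eq_bigr => k _.
by rewrite !simp !sums; ring.
Qed.

Lemma br_dilation_kinetic : br dilation kinetic = 2 * kinetic.
Proof.
rewrite (br_sumr P) [in RHS]/kinetic mulr_sumr; apply: eq_bigr => k _.
by rewrite !simp !sums; ring.
Qed.

Lemma br_dilation_radius2 : br dilation radius2 = - 2 * radius2.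
Proof.
rewrite (br_sumr P) [in RHS]/radius2 mulr_sumr; apply: eq_bigr => k _.
by rewrite !simp !sums; ring.
Qed.

Lemma br_rotation_sums : [/\ br rotation kinetic = 0, br rotation radius2 = 0
  & br rotation dilation = 0].
Proof.
by split; rewrite (br_sumr P) big1 // => k _; rewrite !simp !sums; ring.
Qed.

(** In the complex variables z_k = x_k + i y_k and w_k = u_k + i v_k, the
    function plane_rotation k is the imaginary part of conj z_k * w_k, the
    combination Qgen - i Pgen is the minor z_i w_k - z_k w_i, and Rgen + i
    Sgen is conj z_i * w_k - z_k * conj w_i, an element of u(n). *)
Definition plane_rotation i := x i * v i - y i * u i.
Definition Pgen i k := y k * u i - x i * v k + x k * v i - y i * u k.
Definition Qgen i k := x i * u k - x k * u i - y i * v k + y k * v i.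
Definition minor2 i k := Pgen i k * Pgen i k + Qgen i k * Qgen i k.
Definition Rgen i k := x i * u k - x k * u i + y i * v k - y k * v i.
Definition Sgen i k := x i * v k + x k * v i - y i * u k - y k * u i.
Definition triple i j k := 4 * (Pgen i k * (Pgen i j * Rgen j k - Qgen i j * Sgen j k)
   + Qgen i k * (Pgen i j * Sgen j k + Qgen i j * Rgen j k)).

(** Invariance under the flow of dilation and the flows of the functions of
    which the Hamiltonian is composed. *)
Definition unitary_invariant f :=
  [/\ br kinetic f = 0, br radius2 f = 0, br rotation f = 0, br dilation f = 0
    & br f L = 0].

Lemma plane_rotation_invariant i : unitary_invariant (plane_rotation i).
Proof. by split; rewrite !simp ?sums; ring. Qed.

Lemma br_gen_sums i k :
  (br kinetic (Pgen i k) = 0) * (br kinetic (Qgen i k) = 0) *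
  (br radius2 (Pgen i k) = 0) * (br radius2 (Qgen i k) = 0) *
  (br dilation (Pgen i k) = 0) * (br dilation (Qgen i k) = 0) *
  (br rotation (Pgen i k) = 2 * Qgen i k) * (br rotation (Qgen i k) = - 2 * Pgen i k) *
  (br (Pgen i k) L = 0) * (br (Qgen i k) L = 0).
Proof. by repeat split; rewrite /Pgen /Qgen !simp ?sums; ring. Qed.

(** The flow of rotation multiplies the minor z_i w_k - z_k w_i by a phase: it
    mixes Pgen and Qgen, and only the squared modulus of the minor is
    invariant. *)
Lemma minor2_invariant i k : unitary_invariant (minor2 i k).
Proof.
by split; rewrite /minor2 ?(brDr P) ?brDl ?(brMr P) ?brMl !br_gen_sums; ring.
Qed.

Lemma unitary_invariant_bracket f g : unitary_invariant f -> unitary_invariant g ->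
  unitary_invariant (br f g).
Proof.
move=> [f1 f2 f3 f4 f5] [g1 g2 g3 g4 g5].
have c h : br h f = 0 -> br h g = 0 -> br h (br f g) = 0.
  by move=> hf hg; rewrite (bracketJ P) hf hg (br0l P) -(mulr0 0) (brMr P) !mul0r !addr0.
split; try exact: c.
by rewrite brC c ?oppr0 // brC ?f5 ?g5 oppr0.
Qed.

Lemma br_delta (i k : 'I_n) (G : 'I_n -> A) : (i == k)%:R * G i = (i == k)%:R * G k.
Proof. by case: eqVneq => [->//|_]; rewrite !mul0r. Qed.

Lemma br_plane_rotation k i :
  (br (x k) (plane_rotation i) = - ((k == i)%:R * y k)) *
  (br (y k) (plane_rotation i) = (k == i)%:R * x k) *
  (br (u k) (plane_rotation i) = - ((k == i)%:R * v k)) *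
  (br (v k) (plane_rotation i) = (k == i)%:R * u k).
Proof.
rewrite (br_delta k i y) (br_delta k i x) (br_delta k i u) (br_delta k i v).
by repeat split; rewrite !simp; ring.
Qed.

Lemma br_plane_rotations i j : br (plane_rotation i) (plane_rotation j) = 0.
Proof. by rewrite {1}/plane_rotation !(brDl, brNl P, brMl) !br_plane_rotation; ring. Qed.

(** The rotation of a single plane also multiplies the minor by a phase. *)
Lemma br_minor2_plane_rotation i k j : br (minor2 i k) (plane_rotation j) = 0.
Proof.
have p : br (Pgen i k) (plane_rotation j) = - ((i == j)%:R + (k == j)%:R) * Qgen i k.
  by rewrite /Pgen /Qgen !(brDl, brNl P, brMl) !br_plane_rotation; ring.
have q : br (Qgen i k) (plane_rotation j) = ((i == j)%:R + (k == j)%:R) * Pgen i k.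
  by rewrite /Pgen /Qgen !(brDl, brNl P, brMl) !br_plane_rotation; ring.
by rewrite /minor2 brDl !brMl p q; ring.
Qed.

Lemma br_gens i j k : i != j -> i != k -> j != k ->
  (br (Pgen i j) (Pgen i k) = Rgen j k) * (br (Qgen i j) (Qgen i k) = Rgen j k) *
  (br (Pgen i j) (Qgen i k) = Sgen j k) * (br (Pgen i k) (Qgen i j) = Sgen j k).
Proof.
move=> ij ik jk; have ji : j != i by rewrite eq_sym.
have ki : k != i by rewrite eq_sym.
have kj : k != j by rewrite eq_sym.
by repeat split; rewrite !simp !eqxx ?(negPf ij) ?(negPf ik) ?(negPf jk) ?(negPf ji)
  ?(negPf ki) ?(negPf kj); rewrite /Rgen /Sgen
  ?mulr1n ?mulr0n; ring.
Qed.

Lemma br_minor2 i j k : i != j -> i != k -> j != k ->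
  br (minor2 i j) (minor2 i k) = triple i j k.
Proof.
move=> ij ik jk; have [[[pp qq] pq] kj] := br_gens ij ik jk.
rewrite /minor2 brDl !brMl !(brDr P) !(brMr P) (brC (Qgen i j) (Pgen i k)).
by rewrite pp qq pq kj /triple; ring.
Qed.

Variables (c w : A).
Hypotheses (c2 : 2 * c = 1) (w1 : w * (1 + radius2) = 1).

Definition hamiltonian := c * (kinetic - L * rotation + c * c * L * L * radius2
  - (rotation - c * L * radius2) * (rotation - c * L * radius2) * w).
(** The quadratic Casimir function |p|^2 |q|^2 - <q, p>^2 of so(2n), which is
    also the Casimir function of the sl_2 spanned by kinetic, radius2 and
    dilation. It commutes with all the integrals and depends on them, and is
    the last member of the family center_spec. *)
Definition casimir := kinetic * radius2 - dilation * dilation.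

Let brc f : br c f = 0. Proof. exact: (br_half P). Qed.

Lemma hamiltonian_commute f : br kinetic f = 0 -> br radius2 f = 0 ->
  br rotation f = 0 -> br L f = 0 -> br hamiltonian f = 0.
Proof.
move=> kf rf mf Lf.
have wf : br w f = 0 by apply: (br_inverse P w1); rewrite brDl (br1l P) rf addr0.
by rewrite /hamiltonian !(brDl, brMl, brNl P) kf rf mf Lf wf brc; ring.
Qed.

Lemma casimir_commute f : br kinetic f = 0 -> br radius2 f = 0 ->
  br dilation f = 0 -> br casimir f = 0.
Proof.
move=> kf rf df.
by rewrite /casimir !(brDl, brMl, brNl P) kf rf df; ring.
Qed.

Lemma unitary_invariant_commute f : unitary_invariant f ->
  [/\ br hamiltonian f = 0, br casimir f = 0 & br L f = 0].
Proof.
move=> [kf rf mf df fL]; have Lf : br L f = 0 by rewrite brC fL oppr0.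
by split => //; [exact: hamiltonian_commute | exact: casimir_commute].
Qed.

Lemma hamiltonian_L : br hamiltonian L = 0.
Proof.
have [kL rL mL dL] := br_sum_L.
by apply: hamiltonian_commute => //; exact: (bracketff P).
Qed.

Lemma casimir_L : br casimir L = 0.
Proof. by have [kL rL mL dL] := br_sum_L; exact: casimir_commute. Qed.

Lemma hamiltonian_casimir : br hamiltonian casimir = 0.
Proof.
have [mk mr md] := br_rotation_sums.
have rk := br_radius2_kinetic; have dk := br_dilation_kinetic.
have dr := br_dilation_radius2.
have kr : br kinetic radius2 = - (4 * dilation) by rewrite brC rk.
have kd : br kinetic dilation = - (2 * kinetic) by rewrite brC dk.
have rd : br radius2 dilation = 2 * radius2 by rewrite brC dr; ring.
have kk := bracketff P kinetic; have rr := bracketff P radius2.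
apply: hamiltonian_commute; rewrite ?casimir_L // /casimir.
- by rewrite !(brDr P, brMr P, brNr P) kk kr kd; ring.
- by rewrite !(brDr P, brMr P, brNr P) rr rk rd; ring.
- by rewrite !(brDr P, brMr P, brNr P) mk mr md; ring.
- by rewrite brC casimir_L oppr0.
Qed.

Variable o : 'I_n.
Hypothesis o0 : o = 0%N :> nat.

Let neo (k : 'I_n) : (0 < k)%N -> k != o.
Proof. by move=> k0; rewrite -val_eqE /= o0; case: (k : nat) k0. Qed.

(** g is the integral of index i, where the planes are numbered from 0, o is
    the first one and a the second one. *)
Definition integral_spec (a : 'I_n) (i : nat) (g : A) : Prop :=
  [\/ i = 0%N /\ g = hamiltonian,
      exists j : 'I_n, i = j.+1 /\ g = plane_rotation j,
      exists k : 'I_n, [/\ (0 < k)%N, i = (n + k)%N & g = minor2 o k]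
    | i = (n + n)%N /\ g = L]
  \/ exists k : 'I_n, [/\ (1 < k)%N, a = 1%N :> nat, i = (n + n + k).-1 & g = triple o a k].

(** The n + 3 commuting functions whose differentials, at a generic point and
    for n > 1, span the kernel of the Poisson tensor on the differentials of
    the integrals. *)
Definition center_spec (i : nat) (g : A) : Prop :=
  [\/ i = 0%N /\ g = hamiltonian,
      exists j : 'I_n, i = j.+1 /\ g = plane_rotation j,
      i = n.+1 /\ g = L
    | i = n.+2 /\ g = casimir].

Lemma hamiltonian_center j h : center_spec j h -> br hamiltonian h = 0.
Proof.
case=> [[_ ->]|[k [_ ->]]|[_ ->]|[_ ->]].
- exact: (bracketff P).
- by have [] := unitary_invariant_commute (plane_rotation_invariant k).
- exact: hamiltonian_L.
- exact: hamiltonian_casimir.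
Qed.

Lemma momentum_center j h : center_spec j h -> br L h = 0.
Proof.
case=> [[_ ->]|[k [_ ->]]|[_ ->]|[_ ->]].
- by rewrite brC hamiltonian_L oppr0.
- by have [_ _] := unitary_invariant_commute (plane_rotation_invariant k).
- exact: (bracketff P).
- by rewrite brC casimir_L oppr0.
Qed.

Lemma invariant_center g j h : unitary_invariant g ->
  (forall k, br g (plane_rotation k) = 0) -> center_spec j h -> br g h = 0.
Proof.
move=> gi gJ; have [gH gK gL] := unitary_invariant_commute gi.
by case=> [[_ ->]|[k [_ ->]]|[_ ->]|[_ ->]] //; rewrite brC ?gH ?gK ?gL oppr0.
Qed.

(** For a triple, which is the bracket of two squared minors, the Jacobi
    identity reduces the claim to these minors. *)
Lemma integral_center a i g j h :
  integral_spec a i g -> center_spec j h -> br g h = 0.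
Proof.
case=> [[[_ ->]|[k [_ ->]]|[k [_ _ ->]]|[_ ->]]|[k [k1 a1 _ ->]]] hh.
- exact: hamiltonian_center hh.
- by apply: invariant_center hh; [exact: plane_rotation_invariant | exact: br_plane_rotations].
- by apply: invariant_center hh; [exact: minor2_invariant | exact: br_minor2_plane_rotation].
- exact: momentum_center hh.
- have ao : a != o by apply: neo; rewrite a1.
  have ko : k != o by apply: neo; apply: ltnW.
  have ak : a != k by rewrite -val_eqE /= a1; case: (k : nat) k1 => [|[]].
  rewrite -br_minor2 // 1?eq_sym //; apply: invariant_center hh => [|l].
    by apply: unitary_invariant_bracket; exact: minor2_invariant.
  have M0 m : br (plane_rotation l) (minor2 o m) = 0.
    by rewrite brC br_minor2_plane_rotation oppr0.
  by rewrite brC (bracketJ P) !M0 (br0l P) brC (br0l P) oppr0 addr0 oppr0.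
Qed.

Lemma center_center i g j h : center_spec i g -> center_spec j h -> br g h = 0.
Proof.
case=> [[_ ->]|[k [_ ->]]|[_ ->]|[_ ->]] hh.
- exact: hamiltonian_center hh.
- by apply: invariant_center hh; [exact: plane_rotation_invariant | exact: br_plane_rotations].
- exact: momentum_center hh.
- case: hh => [[_ ->]|[k [_ ->]]|[_ ->]|[_ ->]].
  + by rewrite brC hamiltonian_casimir oppr0.
  + by have [] := unitary_invariant_commute (plane_rotation_invariant k).
  + exact: casimir_L.
  + exact: (bracketff P).
Qed.

(** With at most two planes there is at most one squared minor and no triple.
    *)
Lemma integrals_commute a i g j h : (n <= 2)%N ->
  integral_spec a i g -> integral_spec a j h -> br g h = 0.
Proof.
move=> n2 gs; have gc l f : center_spec l f -> br g f = 0 by exact: integral_center gs.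
case=> [[[i0 ->]|[k [jk ->]]|[k [k0 _ ->]]|[_ ->]]|[k [k1 _ _ _]]].
- by apply: (gc 0%N); constructor 1.
- by apply: (gc k.+1); constructor 2; exists k.
- case: gs => [[[_ ->]|[l [_ ->]]|[l [l0 _ ->]]|[_ ->]]|[l [l1 _ _ _]]].
  + by have [] := unitary_invariant_commute (minor2_invariant o k).
  + by rewrite brC br_minor2_plane_rotation oppr0.
  + have -> : l = k by apply: val_inj => /=; have := ltn_ord l; have := ltn_ord k; lia.
    exact: (bracketff P).
  + by have [_ _] := unitary_invariant_commute (minor2_invariant o k).
  + by have := ltn_ord l; lia.
- by apply: (gc n.+1); constructor 3.
- by have := ltn_ord k; lia.
Qed.

(* A point with x_o = 1, all other positions 0, u = (1, ..., 1), v = 0 and L = 0: many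
   terms vanish there, but every integral has a nonzero differential. *)
Section Point.
Variables (B : numDomainType) (ev : {rmorphism A -> B}).
Hypotheses (ev_x : forall i, ev (x i) = (i == o)%:R) (ev_y : forall i, ev (y i) = 0)
  (ev_u : forall i, ev (u i) = 1) (ev_v : forall i, ev (v i) = 0) (ev_L : ev L = 0).

Let evE := (rmorphD, rmorphN, rmorphM, rmorph_nat, rmorph0, rmorph1, ev_x, ev_y, ev_u, ev_v, ev_L).

Lemma ev_kinetic : ev kinetic = n%:R.
Proof.
rewrite rmorph_sum (eq_bigr (fun=> 1)) ?sumr_const ?card_ord // => k _.
by rewrite !evE; ring.
Qed.

Lemma ev_radius2 : ev radius2 = 1.
Proof.
rewrite rmorph_sum (bigD1 o) //= big1 => [|k /negPf ko]; rewrite !evE ?eqxx ?ko ?mulr1n ?mulr0n; ring.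
Qed.

Lemma ev_rotation : ev rotation = 0.
Proof. by rewrite rmorph_sum big1 // => k _; rewrite !evE; ring. Qed.

Lemma ev_hamiltonian_dilation : ev (br hamiltonian dilation) = - n%:R.
Proof.
have [mk mr md] := br_rotation_sums; have [_ _ _ dL] := br_sum_L.
have Ld : br L dilation = 0 by rewrite brC dL oppr0.
have kd : br kinetic dilation = - (2 * kinetic) by rewrite brC br_dilation_kinetic.
have ec : 2 * ev c = 1 by rewrite -(rmorph_nat ev 2) -rmorphM c2 rmorph1.
rewrite /hamiltonian !(brDl, brMl, brNl P) brc md Ld kd !evE ev_kinetic ev_rotation.
transitivity (- (2 * ev c) * n%:R); last by rewrite ec mulN1r.
ring.
Qed.

Lemma ev_minor2_x i k : i != o -> k != o -> ev (br (minor2 o i) (x k)) = - 2 * (i == k)%:R.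
Proof.
move=> io ko; have oi : o != i by rewrite eq_sym.
have ok : o != k by rewrite eq_sym.
rewrite /minor2 /Pgen /Qgen !simp !evE !eqxx ?(negPf io) ?(negPf ko) ?(negPf oi) ?(negPf ok)
  ?mulr1n ?mulr0n.
ring.
Qed.

Lemma ev_plane_rotation_x i k : ev (br (plane_rotation i) (x k)) = 0.
Proof. by rewrite brC br_plane_rotation !evE; ring. Qed.

Lemma ev_plane_rotation_v i k : ev (br (plane_rotation i) (v k)) = - (k == i)%:R.
Proof. by rewrite brC br_plane_rotation !evE; ring. Qed.

(** At the point both minors z_o w_i - z_i w_o and z_o w_a - z_a w_o equal 1,
    while Rgen and Sgen vanish, so the differential of the triple is four
    times that of Rgen. *)
Lemma ev_triple a i t : i != o -> a != o ->
  ev (br (triple o a i) t) = 4 * ev (br (Rgen a i) t).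
Proof.
move=> io ao; have gen p1 q1 p q r s : ev p1 = 0 -> ev q1 = 1 -> ev p = 0 -> ev q = 1 ->
    ev r = 0 -> ev s = 0 ->
    ev (br (4 * (p * (p1 * r - q1 * s) + q * (p1 * s + q1 * r))) t) = 4 * ev (br r t).
  move=> e1 e2 e3 e4 e5 e6; rewrite !(brMl, brDl, brNl P, br_natl P) !evE e1 e2 e3 e4 e5 e6.
  ring.
by apply: gen; rewrite /Pgen /Qgen /Rgen /Sgen !evE ?eqxx ?(negPf io) ?(negPf ao)
  ?mulr1n ?mulr0n; ring.
Qed.

Lemma ev_triple_x a i k : i != o -> a != o -> ev (br (triple o a i) (x k)) = 0.
Proof.
move=> io ao; rewrite ev_triple // /Rgen !simp !evE ?(negPf io) ?(negPf ao) ?mulr0n.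
ring.
Qed.

Lemma ev_triple_v a i k : i != o -> a != o -> ev (br (triple o a i) (v k)) = 0.
Proof. by move=> io ao; rewrite ev_triple // /Rgen !simp !evE; ring. Qed.

Lemma ev_triple_u a i k : i != o -> a != o -> k != a ->
  ev (br (triple o a i) (u k)) = - 4 * (i == k)%:R.
Proof.
move=> io ao ka; have ak : a != k by rewrite eq_sym.
by rewrite ev_triple // /Rgen !simp !evE (negPf ak) ?mulr0n; ring.
Qed.

Lemma ev_casimir_x k : k != o -> ev (br casimir (x k)) = - 2.
Proof.
move=> ko; rewrite /casimir !(brDl, brMl, brNl P) !sums !evE ev_radius2 (negPf ko) mulr0n.
ring.
Qed.

Lemma independent_step m (f : 'I_m -> A) (cf : 'I_m -> B) t i :
  \sum_j cf j * ev (br (f j) t) = 0 ->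
  (forall j, j != i -> cf j * ev (br (f j) t) = 0) ->
  ev (br (f i) t) != 0 -> cf i = 0.
Proof.
move=> s0 others nz; move: s0; rewrite (bigD1 i) //= big1 // addr0 => /eqP.
by rewrite mulf_eq0 (negPf nz) orbF => /eqP.
Qed.

Let minor2_dilation i k : br (minor2 i k) dilation = 0.
Proof. by rewrite brC; have [_ _ _ -> _] := minor2_invariant i k; rewrite oppr0. Qed.

Let plane_rotation_dilation i : br (plane_rotation i) dilation = 0.
Proof. by rewrite brC; have [_ _ _ -> _] := plane_rotation_invariant i; rewrite oppr0. Qed.

Let L_dilation : br L dilation = 0.
Proof. by rewrite brC; have [_ _ _ ->] := br_sum_L; rewrite oppr0. Qed.

Let casimir_dilation : br casimir dilation = 0.
Proof.
rewrite /casimir !(brDl, brMl, brNl P) (bracketff P) (brC radius2) (brC kinetic).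
by rewrite br_dilation_kinetic br_dilation_radius2; ring.
Qed.

Let hamiltonian_nz : (0 < n)%N -> ev (br hamiltonian dilation) != 0.
Proof. by move=> n0; rewrite ev_hamiltonian_dilation oppr_eq0 pnatr_eq0 -lt0n. Qed.

Let Lz : ev (br L z) = - 1.
Proof. by rewrite brC (br_zL F) rmorphN rmorph1. Qed.

(** A relation between the differentials gives the same relation between the
    brackets with any test function t. The test functions are taken in the
    order dilation, x k, v k, u k, z; among the integrals not yet eliminated,
    each of them has a nonzero bracket at the point with just one: the
    Hamiltonian, the squared minor of index k, the rotation of the plane k,
    the triple of index k, and L. *)
Lemma integrals_independent (a : 'I_n) m (f : 'I_m -> A) (cf : 'I_m -> B) :
  (forall i : 'I_m, integral_spec a i (f i)) ->
  (forall t, \sum_i cf i * ev (br (f i) t) = 0) -> forall i, cf i = 0.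
Proof.
move=> spec s0; have n0 : (0 < n)%N by case: (o) => k; case: (n).
have trd (k : 'I_n) : (1 < k)%N -> a = 1%N :> nat -> br (triple o a k) dilation = 0.
  move=> k1 a1; have ao : a != o by apply: neo; rewrite a1.
  have ko : k != o by apply: neo; apply: ltnW.
  have ak : a != k by rewrite -val_eqE /= a1; case: (k : nat) k1 => [|[]].
  rewrite -br_minor2 // 1?eq_sym // brC.
  by have [_ _ _ ->] := unitary_invariant_bracket (minor2_invariant o a) (minor2_invariant o k); rewrite oppr0.
have hH (i : 'I_m) : i = 0%N :> nat -> cf i = 0.
  move=> i0; apply: (independent_step (s0 dilation)) => [j|].
    rewrite -val_eqE /= i0 => ji.
    case: (spec j) => [[[j0 _]|[k [_ ->]]|[k [_ _ ->]]|[_ ->]]|[k [k1 a1 _ ->]]].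
    - by rewrite j0 in ji.
    - by rewrite plane_rotation_dilation rmorph0 mulr0.
    - by rewrite minor2_dilation rmorph0 mulr0.
    - by rewrite L_dilation rmorph0 mulr0.
    - by rewrite trd // rmorph0 mulr0.
  case: (spec i) => [[[_ ->]|[k [jk _]]|[k [k0 jk _]]|[jk _]]|[k [k1 _ jk _]]];
    [exact: hamiltonian_nz|lia..].
have ao k : (1 < k)%N -> a = 1%N :> nat -> a != o by move=> _ a1; apply: neo; rewrite a1.
have hW (k : 'I_n) (i : 'I_m) : (0 < k)%N -> i = (n + k)%N :> nat -> cf i = 0.
  move=> k0 ik; apply: (independent_step (s0 (x k))) => [j|].
    rewrite -val_eqE /= ik => ji.
    case: (spec j) => [[[j0 _]|[l [_ ->]]|[l [l0 jl ->]]|[_ ->]]|[l [l1 a1 _ ->]]].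
    - by rewrite hH ?mul0r.
    - by rewrite ev_plane_rotation_x mulr0.
    - rewrite ev_minor2_x ?neo // (_ : (l == k) = false) ?mulr0n ?mulr0 //.
      by apply/negP => /eqP lk; move: ji; rewrite jl lk eqxx.
    - by rewrite Lx rmorph0 mulr0.
    - by rewrite ev_triple_x ?mulr0 ?neo ?a1 // ltnW.
  case: (spec i) => [[[jk _]|[l [jk _]]|[l [l0 jk ->]]|[jk _]]|[l [l1 _ jk _]]];
    try (have := ltn_ord k; have := ltn_ord l; lia); try (have := ltn_ord k; lia).
  have -> : l = k by apply: val_inj => /=; lia.
  by rewrite ev_minor2_x ?neo // eqxx mulr1 oppr_eq0 pnatr_eq0.
have hJ (k : 'I_n) (i : 'I_m) : i = k.+1 :> nat -> cf i = 0.
  move=> ik; apply: (independent_step (s0 (v k))) => [j|].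
    rewrite -val_eqE /= ik => ji.
    case: (spec j) => [[[j0 _]|[l [jl ->]]|[l [l0 jl ->]]|[_ ->]]|[l [l1 a1 _ ->]]].
    - by rewrite hH ?mul0r.
    - rewrite ev_plane_rotation_v (_ : (k == l) = false) ?mulr0n ?oppr0 ?mulr0 //.
      by apply/negP => /eqP lk; move: ji; rewrite jl lk eqxx.
    - by rewrite (hW l) ?mul0r.
    - by rewrite Lv rmorph0 mulr0.
    - by rewrite ev_triple_v ?mulr0 ?neo ?a1 // ltnW.
  case: (spec i) => [[[jk _]|[l [jk ->]]|[l [l0 jk _]]|[jk _]]|[l [l1 _ jk _]]];
    try (have := ltn_ord k; have := ltn_ord l; lia); try (have := ltn_ord k; lia).
  have -> : l = k by apply: val_inj => /=; lia.
  by rewrite ev_plane_rotation_v eqxx oppr_eq0 oner_eq0.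
have hT (k : 'I_n) (i : 'I_m) : (1 < k)%N -> a = 1%N :> nat -> i = (n + n + k).-1 :> nat -> cf i = 0.
  move=> k1 a1 ik; apply: (independent_step (s0 (u k))) => [j|].
    rewrite -val_eqE /= ik => ji.
    case: (spec j) => [[[j0 _]|[l [jl ->]]|[l [l0 jl ->]]|[_ ->]]|[l [l1 _ jl ->]]].
    - by rewrite hH ?mul0r.
    - by rewrite (hJ l) ?mul0r.
    - by rewrite (hW l) ?mul0r.
    - by rewrite Lu rmorph0 mulr0.
    - rewrite ev_triple_u ?neo ?a1 // 1?ltnW //; last first.
        by rewrite -val_eqE /= a1; case: (k : nat) k1 => [|[]].
      rewrite (_ : (l == k) = false) ?mulr0n ?mulr0 //.
      by apply/negP => /eqP lk; move: ji; rewrite jl lk eqxx.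
  case: (spec i) => [[[jk _]|[l [jk _]]|[l [l0 jk _]]|[jk _]]|[l [l1 _ jk ->]]];
    try (have := ltn_ord k; have := ltn_ord l; lia); try (have := ltn_ord k; lia).
  have -> : l = k by apply: val_inj => /=; lia.
  rewrite ev_triple_u ?neo ?a1 // 1?ltnW // ?eqxx ?mulr1 ?oppr_eq0 ?pnatr_eq0 //.
  by rewrite -val_eqE /= a1; case: (k : nat) k1 => [|[]].
move=> i; case: (spec i) => [[[i0 _]|[k [ik _]]|[k [k0 ik _]]|[ik fi]]|[k [k1 a1 ik _]]].
- exact: hH.
- exact: (hJ k).
- exact: (hW k).
- apply: (independent_step (s0 z)) => [j|]; last by rewrite fi Lz oppr_eq0 oner_eq0.
  rewrite -val_eqE /= ik => ji.
  case: (spec j) => [[[j0 _]|[l [jl ->]]|[l [l0 jl ->]]|[jl _]]|[l [l1 a1 jl ->]]].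
  + by rewrite hH ?mul0r.
  + by rewrite (hJ l) ?mul0r.
  + by rewrite (hW l) ?mul0r.
  + by rewrite jl eqxx in ji.
  + by rewrite (hT l) ?mul0r.
- exact: (hT k).
Qed.

(** The same elimination, with the test functions dilation for the
    Hamiltonian, x a for the Casimir function, v k for the rotation of the
    plane k and z for L. *)
Lemma center_independent (a : 'I_n) m (f : 'I_m -> A) (cf : 'I_m -> B) :
  a != o -> (forall i : 'I_m, center_spec i (f i)) ->
  (forall t, \sum_i cf i * ev (br (f i) t) = 0) -> forall i, cf i = 0.
Proof.
move=> ao spec s0; have n0 : (0 < n)%N by case: (o) => k; case: (n).
have hH (i : 'I_m) : i = 0%N :> nat -> cf i = 0.
  move=> i0; apply: (independent_step (s0 dilation)) => [j|].
    rewrite -val_eqE /= i0 => ji.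
    case: (spec j) => [[j0 _]|[k [_ ->]]|[_ ->]|[_ ->]].
    - by rewrite j0 in ji.
    - by rewrite plane_rotation_dilation rmorph0 mulr0.
    - by rewrite L_dilation rmorph0 mulr0.
    - by rewrite casimir_dilation rmorph0 mulr0.
  by case: (spec i) => [[_ ->]|[k [jk _]]|[jk _]|[jk _]]; [exact: hamiltonian_nz|lia..].
have hK (i : 'I_m) : i = n.+2 :> nat -> cf i = 0.
  move=> ik; apply: (independent_step (s0 (x a))) => [j|].
    rewrite -val_eqE /= ik => ji.
    case: (spec j) => [[j0 _]|[k [_ ->]]|[_ ->]|[jk _]].
    - by rewrite hH ?mul0r.
    - by rewrite ev_plane_rotation_x mulr0.
    - by rewrite Lx rmorph0 mulr0.
    - by rewrite jk eqxx in ji.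
  case: (spec i) => [[jk _]|[k [jk _]]|[jk _]|[_ ->]];
    try (have := ltn_ord k; lia); try lia.
  by rewrite ev_casimir_x // oppr_eq0 pnatr_eq0.
have hJ (k : 'I_n) (i : 'I_m) : i = k.+1 :> nat -> cf i = 0.
  move=> ik; apply: (independent_step (s0 (v k))) => [j|].
    rewrite -val_eqE /= ik => ji.
    case: (spec j) => [[j0 _]|[l [jl ->]]|[_ ->]|[jk _]].
    - by rewrite hH ?mul0r.
    - rewrite ev_plane_rotation_v (_ : (k == l) = false) ?mulr0n ?oppr0 ?mulr0 //.
      by apply/negP => /eqP lk; move: ji; rewrite jl lk eqxx.
    - by rewrite Lv rmorph0 mulr0.
    - by rewrite hK ?mul0r.
  case: (spec i) => [[jk _]|[l [jk ->]]|[jk _]|[jk _]];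
    try (have := ltn_ord k; lia).
  have -> : l = k by apply: val_inj => /=; lia.
  by rewrite ev_plane_rotation_v eqxx oppr_eq0 oner_eq0.
move=> i; case: (spec i) => [[i0 _]|[k [ik _]]|[ik fi]|[ik _]].
- exact: hH.
- exact: (hJ k).
- apply: (independent_step (s0 z)) => [j|]; last by rewrite fi Lz oppr_eq0 oner_eq0.
  rewrite -val_eqE /= ik => ji.
  case: (spec j) => [[j0 _]|[l [jl ->]]|[jl _]|[jl ->]].
  + by rewrite hH ?mul0r.
  + by rewrite (hJ l) ?mul0r.
  + by rewrite jl eqxx in ji.
  + by rewrite hK ?mul0r.
- exact: hK.
Qed.

End Point.

End UnitaryFirstIntegrals.

(** * Evaluation and canonical coordinates *)

Section EvaluationMorphism.
Variables (R : realType) (N : nat) (p : 'rV[R]_N).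

Definition evaluate (f : ratfun R N) : R := f p.

Fact evaluate_zmod_morphism : zmod_morphism evaluate. Proof. by []. Qed.
Fact evaluate_monoid_morphism : monoid_morphism evaluate. Proof. by []. Qed.

HB.instance Definition _ := GRing.isZmodMorphism.Build (ratfun R N) R evaluate evaluate_zmod_morphism.
HB.instance Definition _ := GRing.isMonoidMorphism.Build (ratfun R N) R evaluate evaluate_monoid_morphism.

End EvaluationMorphism.

Arguments evaluate : simpl never.

Section RationalBracket.
Variables (R : realType) (d : nat).
Notation A := (ratfun R (d + d)).

Lemma ratfunP (f : A) : rational_fun f.
Proof. by case: f => f /= /rational_predP. Qed.

Definition mkrat f (rf : rational_fun f) : A := RatFun (introT (rational_predP f) rf).

Definition rat_bracket (f g : A) : A := mkrat (rational_poisson (ratfunP f) (ratfunP g)).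

Lemma rat_bracketP : poisson_bracket rat_bracket.
Proof.
split.
- move=> f g h; apply: val_inj; exact: (poissonDl _ (ratfunP f) (ratfunP g)).
- move=> f g h; apply: val_inj; exact: (poissonMl _ (ratfunP f) (ratfunP g)).
- move=> f g; apply: val_inj; exact: poissonC.
- move=> f; apply: val_inj; exact: poissonff.
- move=> f g h; apply: val_inj; exact: (jacobi (ratfunP f) (ratfunP g) (ratfunP h)).
Qed.

Definition rat_cst (c : R) : A := mkrat (@rational_cst R (d + d) c).
Definition position (i : 'I_d) : A := mkrat (@rational_coord R (d + d) (lshift d i)).
Definition momentum (i : 'I_d) : A := mkrat (@rational_coord R (d + d) (rshift d i)).

Lemma position_momentum i j : rat_bracket (position i) (momentum j) = (i == j)%:R.
Proof.
apply: val_inj; rewrite /= poissonE; apply/funext => p.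
rewrite (bigD1 i) //= big1 ?addr0 => [|k ki]; rewrite !partial_coord /cst.
  rewrite eqxx !(inj_eq (@rshift_inj _ _)) eq_lrshift eq_rlshift mul0r subr0 mul1r eq_sym.
  by case: (i == j).
by rewrite !(inj_eq (@lshift_inj _ _)) eq_lrshift (eq_sym i) (negPf ki) !mul0r subrr.
Qed.

Lemma position_position i j : rat_bracket (position i) (position j) = 0.
Proof.
apply: val_inj; rewrite /= poissonE; apply/funext => p.
by rewrite big1 // => k _; rewrite !partial_coord /cst !eq_lrshift mulr0 mul0r subrr.
Qed.

Lemma momentum_momentum i j : rat_bracket (momentum i) (momentum j) = 0.
Proof.
apply: val_inj; rewrite /= poissonE; apply/funext => p.
by rewrite big1 // => k _; rewrite !partial_coord /cst !eq_rlshift mulr0 mul0r subrr.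
Qed.

(** The bracket of f i with t is the value of the differential of f i on the
    Hamiltonian vector field of t. *)
Lemma gradient_mx_row_free m (f : 'I_m -> A) p :
  (forall c : 'I_m -> R,
     (forall t : A, \sum_i c i * evaluate p (rat_bracket (f i) t) = 0) -> forall i, c i = 0) ->
  row_free (gradient_mx f p).
Proof.
move=> ind; rewrite -kermx_eq0; apply/rowV0P => c /sub_kermxP cJ; apply/rowP => i.
rewrite mxE; apply: (ind (fun i => c 0 i)) => t.
transitivity (poisson_tensor (c *m gradient_mx f p) (gradient t p)); last first.
  by rewrite cJ poisson_tensorE !mul0mx mxE.
rewrite poisson_tensorE -!mulmxA mxE; apply: eq_bigr => k _; congr (_ * _).
rewrite /evaluate /= /poisson poisson_tensorE -mulmxA.
by rewrite -[gradient (f k) p](rowK (fun i => gradient (f i) p)) -row_mul [LHS]mxE.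
Qed.

End RationalBracket.

(** * The Hamiltonian on the Heisenberg group *)

Section HeisenbergFrame.
Variables (R : realType) (n : nat).
Notation d := (n + n).+1.
Notation A := (ratfun R (d + d)).
Local Notation br := (@rat_bracket R d).
Implicit Types (p : phase R n) (i j k : 'I_n).

Definition x_index k : 'I_d := inord k.
Definition y_index k : 'I_d := inord (n + k).
Definition z_index : 'I_d := inord (n + n).

Lemma x_indexK k : x_index k = k :> nat.
Proof. by rewrite inordK //; have := ltn_ord k; lia. Qed.
Lemma y_indexK k : y_index k = (n + k)%N :> nat.
Proof. by rewrite inordK //; have := ltn_ord k; lia. Qed.
Lemma z_indexK : z_index = (n + n)%N :> nat.
Proof. by rewrite inordK. Qed.

Definition hx k : A := position R (x_index k).
Definition hy k : A := position R (y_index k).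
Definition hz : A := position R z_index.
Definition hL : A := momentum R z_index.
Definition lx k : A := momentum R (x_index k).
Definition ly k : A := momentum R (y_index k).
Definition one_half : A := rat_cst d 2^-1.
(** hu and hv are the momenta conjugate to x and y in the coordinates (x, y, z
    - <x, y> / 2) of the group, in which the unitary symmetry of the
    Hamiltonian is linear. *)
Definition hu k : A := lx k + one_half * hy k * hL.
Definition hv k : A := ly k + one_half * hx k * hL.

Lemma half2 : 2 * one_half = 1.
Proof.
apply: val_inj; apply/funext => p.
transitivity (evaluate p (2 * one_half)) => //; rewrite rmorphM rmorph_nat.
by rewrite /evaluate /= /cst mulfV // pnatr_eq0.
Qed.

Lemma indexE : (forall i j, (x_index i == x_index j) = (i == j)) *
  (forall i j, (y_index i == y_index j) = (i == j)) *
  (forall i j, (x_index i == y_index j) = false) *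
  (forall i j, (y_index i == x_index j) = false) *
  (forall i, (x_index i == z_index) = false) *
  (forall i, (y_index i == z_index) = false) *
  (forall i, (z_index == x_index i) = false) *
  (forall i, (z_index == y_index i) = false).
Proof.
have e (a b : 'I_d) : (a == b) = (a == b :> nat) by [].
have ne (a b : 'I_d) : a <> b :> nat -> (a == b) = false.
  by move=> ab; rewrite e; exact/eqP.
do ![split].
- by move=> i j; rewrite e !x_indexK.
- by move=> i j; rewrite e !y_indexK eqn_add2l.
- by move=> i j; apply: ne; rewrite x_indexK y_indexK; have := ltn_ord i; lia.
- by move=> i j; apply: ne; rewrite x_indexK y_indexK; have := ltn_ord j; lia.
- by move=> i; apply: ne; rewrite x_indexK z_indexK; have := ltn_ord i; lia.
- by move=> i; apply: ne; rewrite y_indexK z_indexK; have := ltn_ord i; lia.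
- by move=> i; apply: ne; rewrite x_indexK z_indexK; have := ltn_ord i; lia.
- by move=> i; apply: ne; rewrite y_indexK z_indexK; have := ltn_ord i; lia.
Qed.

Lemma momentum_position (i j : 'I_d) : br (momentum R i) (position R j) = - (i == j)%:R.
Proof. by rewrite (bracketC (rat_bracketP R d)) position_momentum eq_sym. Qed.

Lemma heisenberg_frame : darboux_frame br hx hy hu hv hz hL.
Proof.
have P := rat_bracketP R d.
have hl f : br one_half f = 0 by exact: (br_half P _ half2).
have hr f : br f one_half = 0 by rewrite (bracketC P) hl oppr0.
by split => *; rewrite /hx /hy /hu /hv /hz /hL /lx /ly
  ?(bracketDl P, bracketMl P, brDr P, brMr P, hl, hr, position_position, position_momentum,
    momentum_position, momentum_momentum, indexE, eqxx) ?mulr0n ?mulr1n; ring.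
Qed.

Definition r2 : A := radius2 hx hy.

Lemma evaluate_r2 p : evaluate p (1 + r2) = 1 + \sum_k (hx k p ^+ 2 + hy k p ^+ 2).
Proof.
by rewrite rmorphD rmorph1 rmorph_sum.
Qed.

Lemma r2_nz p : evaluate p (1 + r2) != 0.
Proof.
rewrite evaluate_r2 gt_eqF // ltr_pwDl // sumr_ge0 // => k _.
by rewrite addr_ge0 // sqr_ge0.
Qed.

Definition r2_inverse : A := mkrat (rationalV r2_nz (ratfunP (1 + r2))).

(** The factor 1 / (1 + <q, q>) of the Hamiltonian, in the form expected by
    the abstract computations. *)
Lemma r2_inverseP : r2_inverse * (1 + r2) = 1.
Proof.
apply: val_inj; apply/funext => p.
exact: mulVf (r2_nz p).
Qed.

Lemma hx_xc k p : hx k p = xc p k.+1.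
Proof. by rewrite /xc /Defs.coord [RHS]mxE. Qed.
Lemma hy_yc k p : hy k p = yc p k.+1.
Proof. by rewrite /yc /Defs.coord [RHS]mxE (_ : (n + k.+1).-1 = (n + k)%N) ?addnS. Qed.
Lemma lx_lam k p : lx k p = lam p k.+1.
Proof. by rewrite /lam /Defs.coord [RHS]mxE. Qed.
Lemma ly_lam k p : ly k p = lam p (n + k).+1.
Proof. by rewrite /lam /Defs.coord [RHS]mxE. Qed.
Lemma hL_lam p : hL p = lam p (2 * n + 1).
Proof. by rewrite /lam /Defs.coord [RHS]mxE (_ : (2 * n + 1).-1 = (n + n)%N) ?addn1 ?mul2n ?addnn. Qed.

Lemma evaluateD p (f g : A) : evaluate p (f + g) = evaluate p f + evaluate p g.
Proof. by []. Qed.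
Lemma evaluateM p (f g : A) : evaluate p (f * g) = evaluate p f * evaluate p g.
Proof. by []. Qed.
Lemma evaluateN p (f : A) : evaluate p (- f) = - evaluate p f. Proof. by []. Qed.
Lemma evaluate_nat p k : evaluate p k%:R = k%:R. Proof. exact: rmorph_nat. Qed.
Lemma evaluate_sum p (F : 'I_n -> A) : evaluate p (\sum_k F k) = \sum_k evaluate p (F k).
Proof. exact: rmorph_sum. Qed.

Definition atE := (evaluateD, evaluateM, evaluateN, evaluate_nat).

Lemma evaluate_hx p k : evaluate p (hx k) = xc p k.+1. Proof. exact: hx_xc. Qed.
Lemma evaluate_hy p k : evaluate p (hy k) = yc p k.+1. Proof. exact: hy_yc. Qed.
Lemma evaluate_hL p : evaluate p hL = lam p (2 * n + 1). Proof. exact: hL_lam. Qed.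
Lemma evaluate_lx p k : evaluate p (lx k) = lam p k.+1. Proof. exact: lx_lam. Qed.
Lemma evaluate_ly p k : evaluate p (ly k) = lam p (n + k).+1. Proof. exact: ly_lam. Qed.
Lemma evaluate_one_half p : evaluate p one_half = 2^-1. Proof. by []. Qed.

Definition evE := (evaluate_hx, evaluate_hy, evaluate_hL, evaluate_lx, evaluate_ly,
  evaluate_one_half).

Variable o : 'I_n.
Hypothesis o0 : o = 0%N :> nat.

Lemma PfE k : @Pf R n k = Pgen hx hy hu hv o k.
Proof.
apply/funext => p; transitivity (evaluate p (Pgen hx hy hu hv o k)) => //.
by rewrite !atE !evE o0 addn0 /Pf !addn1; field; rewrite ?pnatr_eq0.
Qed.

Lemma QfE k : @Qf R n k = Qgen hx hy hu hv o k.
Proof.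
apply/funext => p; transitivity (evaluate p (Qgen hx hy hu hv o k)) => //.
by rewrite !atE !evE o0 addn0 /Qf !addn1; field; rewrite ?pnatr_eq0.
Qed.

Lemma RfE (a : 'I_n) k : a = 1%N :> nat -> @Rf R n k = Rgen hx hy hu hv a k.
Proof.
move=> a1; apply/funext => p; transitivity (evaluate p (Rgen hx hy hu hv a k)) => //.
by rewrite !atE !evE a1 /Rf !addn1 !addn2; field; rewrite ?pnatr_eq0.
Qed.

Lemma SfE (a : 'I_n) k : a = 1%N :> nat -> @Sf R n k = Sgen hx hy hu hv a k.
Proof.
move=> a1; apply/funext => p; transitivity (evaluate p (Sgen hx hy hu hv a k)) => //.
by rewrite !atE !evE a1 /Sf !addn1 !addn2; field; rewrite ?pnatr_eq0.
Qed.

Definition rat_hamiltonian : A := hamiltonian hx hy hu hv hL one_half r2_inverse.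

Lemma heis_hamiltonian_sums p :
  let x (k : 'I_n) := xc p k.+1 in let y (k : 'I_n) := yc p k.+1 in
  let a (k : 'I_n) := lam p k.+1 in let b (k : 'I_n) := lam p (n + k).+1 in
  let l := lam p (2 * n + 1) in
  @heis_hamiltonian R n p =
  2^-1 * (\sum_k (a k ^+ 2 + b k ^+ 2) + 2 * l * \sum_k y k * a k
          + l ^+ 2 * \sum_k y k ^+ 2
          - (\sum_k (x k * b k - y k * a k) - l * \sum_k y k ^+ 2) ^+ 2
            / (1 + \sum_k (x k ^+ 2 + y k ^+ 2))).
Proof.
move=> X Y a b l; set aa := \sum_k (a k ^+ 2 + b k ^+ 2).
set ya := \sum_k Y k * a k; set yy := \sum_k Y k ^+ 2.
set m := \sum_k (X k * b k - Y k * a k); set q2 := \sum_k (X k ^+ 2 + Y k ^+ 2).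
rewrite /heis_hamiltonian.
set q := col_mx _ _; set u := col_mx _ 0; set lb := (X in X^T *m _ *m _).
have dotE (s t : 'cV[R]_(n + n)) : (s^T *m t) 0 0 = \sum_(i < n + n) s i 0 * t i 0.
  by rewrite mxE; apply: eq_bigr => i _; rewrite !mxE.
have qq : dot q q = q2.
  rewrite /dot big_split_ord /= -big_split; apply: eq_bigr => k _.
  by rewrite /q !col_mxEu !col_mxEd !mxE !expr2.
have uu : dot u u = yy.
  rewrite /dot big_split_ord /= [X in _ + X]big1 ?addr0 => [|k _].
    by apply: eq_bigr => k _; rewrite /u !col_mxEu !mxE expr2.
  by rewrite /u !col_mxEd !mxE mulr0.
have JqE : Jmx R n *m q = col_mx (- (\col_(k < n) Y k)) (\col_(k < n) X k).
  by rewrite /Jmx /q mul_block_col !mul0mx mul1mx add0r addr0 mulNmx mul1mx.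
have ll : (lb^T *m lb) 0 0 = aa.
  rewrite dotE big_split_ord /= -big_split; apply: eq_bigr => k _.
  by rewrite !mxE !expr2.
have lJ : (lb^T *m (Jmx R n *m q)) 0 0 = m.
  rewrite JqE dotE big_split_ord /= -big_split; apply: eq_bigr => k _.
  by rewrite /= !col_mxEu !col_mxEd !mxE /X /Y /a /b /=; ring.
have Jl : ((Jmx R n *m q)^T *m lb) 0 0 = m.
  by rewrite -lJ !dotE; apply: eq_bigr => i _; rewrite mulrC.
have lu : (lb^T *m u) 0 0 = ya.
  rewrite dotE big_split_ord /= [X in _ + X]big1 ?addr0 => [|k _].
    by apply: eq_bigr => k _; rewrite /u !col_mxEu !mxE mulrC.
  by rewrite /u !col_mxEd !mxE mulr0.
have e1 : (lb^T *m (1%:M - (1 + dot q q)^-1 *: (Jmx R n *m q *m (Jmx R n *m q)^T)) *m lb) 0 0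
    = aa - (1 + q2)^-1 * (m * m).
  rewrite mulmxBr mulmx1 mulmxBl -scalemxAr -scalemxAl mxE ll qq; congr (_ + _).
  rewrite [LHS]mxE [in LHS]mxE; congr (- (_ * _)).
  move: (Jmx R n *m q) lJ Jl => V lV Vl.
  by rewrite mulmxA -(mulmxA _ V^T) mxE big_ord1 lV Vl.
have e2 : (lb^T *m (u + (dot u u / (1 + dot q q)) *: (Jmx R n *m q))) 0 0
    = ya + yy / (1 + q2) * m.
  by rewrite mulmxDr -scalemxAr mxE lu uu qq; congr (_ + _); rewrite mxE lJ.
rewrite e1 e2 qq uu -/l; set w := (1 + q2)^-1; ring.
Qed.

Lemma heis_hamiltonianE : @heis_hamiltonian R n = rat_hamiltonian.
Proof.
apply/funext => p; transitivity (evaluate p rat_hamiltonian) => //.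
rewrite heis_hamiltonian_sums.
pose X (k : 'I_n) := xc p k.+1; pose Y (k : 'I_n) := yc p k.+1.
pose a (k : 'I_n) := lam p k.+1; pose b (k : 'I_n) := lam p (n + k).+1.
pose l := lam p (2 * n + 1).
pose aa := \sum_k (a k ^+ 2 + b k ^+ 2); pose q2 := \sum_k (X k ^+ 2 + Y k ^+ 2).
pose yy := \sum_k Y k ^+ 2; pose m := \sum_k (X k * b k - Y k * a k).
pose ya := \sum_k Y k * a k.
rewrite -/l -/aa -/ya -/yy -/m -/q2.
rewrite /rat_hamiltonian /hamiltonian !atE.
have -> : evaluate p (kinetic hu hv) = aa + l * (ya + \sum_(k < n) X k * b k) + l ^+ 2 * q2 / 4.
  rewrite evaluate_sum /aa /ya /q2 -big_split /= mulr_sumr mulr_sumr mulr_suml -!big_split.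
  by apply: eq_bigr => k _; rewrite !atE !evE /X /Y /a /b /l /=; field.
have -> : evaluate p (rotation hx hy hu hv) = m + l / 2 * (q2 - 2 * yy).
  rewrite evaluate_sum /m /q2 /yy (mulr_sumr _ _ _ 2) -sumrB mulr_sumr -big_split.
  by apply: eq_bigr => k _; rewrite !atE !evE /X /Y /a /b /l /=; field.
have -> : evaluate p (radius2 hx hy) = q2.
  by rewrite evaluate_sum; apply: eq_bigr => k _; rewrite !atE !evE !expr2.
have -> : evaluate p r2_inverse = (1 + q2)^-1.
  rewrite {1}/evaluate /= -/(evaluate p _) evaluate_r2; congr (_ + _)^-1.
  by apply: eq_bigr => k _; rewrite hx_xc hy_yc.
have -> : m = \sum_(k < n) X k * b k - ya by rewrite /m sumrB.
rewrite evaluate_hL -/l evaluate_one_half.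
by move: (\sum_(k < n) _) (1 + q2)^-1 => xb w; field.
Qed.

End HeisenbergFrame.

(** * The sub-Riemannian metric *)

Section SubRiemannianMetric.
Variables (R : realType) (n : nat).
Notation d := (n + n).+1.
Implicit Types (q v w : 'rV[R]_d) (k : 'I_n).
Local Notation xi := (@x_index n).
Local Notation yi := (@y_index n).
Local Notation zi := (z_index n).

Lemma sum_numbered_from_one (F : nat -> R) : \sum_(1 <= k < n.+1) F k = \sum_(k < n) F k.+1.
Proof. by rewrite big_add1 big_mkord. Qed.

Lemma coord_x v k : Defs.coord v k.+1 = v 0 (xi k). Proof. by []. Qed.
Lemma coord_y v k : Defs.coord v (n + k.+1) = v 0 (yi k).
Proof. by rewrite /Defs.coord addnS. Qed.
Lemma coord_z v : Defs.coord v (2 * n + 1) = v 0 zi.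
Proof. by rewrite /Defs.coord addn1 mul2n -addnn. Qed.

Lemma contact_formE q v : contact_form q v = v 0 zi - \sum_k q 0 (xi k) * v 0 (yi k).
Proof.
rewrite /contact_form coord_z sum_numbered_from_one; congr (_ - _).
by apply: eq_bigr => k _; rewrite coord_x coord_y.
Qed.

Lemma right_frame_x k q :
  @right_frame R n (lshift n k) q = delta_mx 0 (xi k) + q 0 (yi k) *: delta_mx 0 zi.
Proof.
rewrite /right_frame /= ltn_ord coord_y /basis_vec /=.
by congr (_ + _ *: delta_mx 0 (inord _)); lia.
Qed.

Lemma right_frame_y k q : @right_frame R n (rshift n k) q = delta_mx 0 (yi k).
Proof. by rewrite /right_frame /= ltnNge leq_addr. Qed.

Definition frame_contact q : 'cV[R]_(n + n) :=
  col_mx (\col_k q 0 (yi k)) (\col_k - q 0 (xi k)).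

Lemma contact_frame a q : contact_form q (right_frame a q) = frame_contact q a 0.
Proof.
rewrite contact_formE; case: (split_ordP a) => k ->.
  rewrite right_frame_x /frame_contact col_mxEu !mxE !indexE !eqxx /= mulr1 add0r.
  by rewrite big1 ?subr0 // => l _; rewrite !mxE !indexE /= mulr0 addr0 mulr0.
rewrite right_frame_y /frame_contact col_mxEd !mxE !indexE /= (bigD1 k) //=.
rewrite big1 ?addr0 => [|l lk]; rewrite !mxE !indexE ?eqxx ?(negPf lk) /= ?mulr0 //.
by rewrite mulr1 sub0r.
Qed.

Lemma right_frame_xcoord a q k : right_frame a q 0 (xi k) = (a == lshift n k)%:R.
Proof.
case: (split_ordP a) => l ->; rewrite ?right_frame_x ?right_frame_y !mxE !indexE eqxx /=.
  by rewrite mulr0 addr0 (inj_eq (@lshift_inj _ _)) eq_sym.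
by rewrite eq_rlshift.
Qed.

Lemma right_frame_ycoord a q k : right_frame a q 0 (yi k) = (a == rshift n k)%:R.
Proof.
case: (split_ordP a) => l ->; rewrite ?right_frame_x ?right_frame_y !mxE !indexE eqxx /=.
  by rewrite mulr0 addr0 eq_lrshift.
by rewrite (inj_eq (@rshift_inj _ _)) eq_sym.
Qed.

(** The frame projects to the standard basis of the (x, y)-space, so only the
    square of the contact form perturbs the identity. *)
Lemma gramE q : gram (@heis_metric R n) (@right_frame R n) q =
  1%:M + frame_contact q *m (frame_contact q)^T.
Proof.
apply/matrixP => a b; rewrite [LHS]mxE [RHS]mxE [1%:M a b]mxE [(_ *m _) a b]mxE big_ord1.
rewrite [_^T 0 b]mxE /heis_metric !contact_frame; congr (_ + _).
rewrite sum_numbered_from_one.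
transitivity (\sum_(i < n + n) (a == i)%:R * (b == i)%:R : R).
  rewrite big_split_ord /= -big_split; apply: eq_bigr => k _.
  by rewrite !coord_x !coord_y !right_frame_xcoord !right_frame_ycoord.
rewrite (bigD1 a) //= eqxx mul1r big1 => [|i ia]; first by rewrite addr0 eq_sym.
by rewrite eq_sym (negPf ia) mul0r.
Qed.

(** The Sherman-Morrison formula for a perturbation of rank one. *)
Lemma gram_inverse q (w := frame_contact q) :
  gram (@heis_metric R n) (@right_frame R n) q *m
    (1%:M - (1 + (w^T *m w) 0 0)^-1 *: (w *m w^T)) = 1%:M.
Proof.
have ww : w *m w^T *m (w *m w^T) = (w^T *m w) 0 0 *: (w *m w^T).
  rewrite mulmxA -(mulmxA w w^T w) scalemxAl -mul_mx_scalar.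
  by congr (_ *m _ *m _); exact: mx11_scalar.
rewrite gramE -/w mulmxBr mulmx1 -scalemxAr mulmxDl mul1mx ww -/w.
set s := (w^T *m w) 0 0; have s1 : 1 + s != 0.
  rewrite gt_eqF // ltr_pwDl // /s mxE sumr_ge0 // => i _.
  by rewrite !mxE -expr2 sqr_ge0.
rewrite -{2}[w *m w^T]scale1r -scalerDl scalerA mulVf // scale1r addrK //.
Qed.

Lemma gram_unit q : gram (@heis_metric R n) (@right_frame R n) q \in unitmx.
Proof. by have /mulmx1_unit[] := gram_inverse q. Qed.

Lemma invmx_gram q (w := frame_contact q) :
  invmx (gram (@heis_metric R n) (@right_frame R n) q) =
  1%:M - (1 + (w^T *m w) 0 0)^-1 *: (w *m w^T).
Proof.
have /(congr1 (mulmx (invmx (gram (@heis_metric R n) (@right_frame R n) q)))) := gram_inverse q.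
by rewrite mulKmx ?gram_unit // mulmx1.
Qed.

Lemma pairing_frame_x l q k :
  pairing l (right_frame (lshift n k) q) = l 0 (xi k) + q 0 (yi k) * l 0 zi.
Proof.
have p i : pairing l (delta_mx 0 i) = l 0 i :> R.
  rewrite /pairing (bigD1 i) //= mxE !eqxx mulr1 big1 ?addr0 // => j ji.
  by rewrite mxE (negPf ji) andbF mulr0.
rewrite right_frame_x -(p (xi k)) -(p zi) /pairing mulr_sumr -big_split.
by apply: eq_bigr => i _; rewrite !mxE /=; ring.
Qed.

Lemma pairing_frame_y l q k : pairing l (right_frame (rshift n k) q) = l 0 (yi k) :> R.
Proof.
rewrite right_frame_y /pairing (bigD1 (yi k)) //= mxE !eqxx mulr1 big1 ?addr0 // => j ji.
by rewrite mxE (negPf ji) andbF mulr0.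
Qed.

Lemma normal_hamiltonianE :
  normal_hamiltonian (@heis_metric R n) (@right_frame R n) = @heis_hamiltonian R n.
Proof.
apply/funext => p; rewrite heis_hamiltonian_sums /normal_hamiltonian.
set q := lsubmx p; set l := rsubmx p; congr (_ * _).
pose w := frame_contact q.
pose lX : 'cV[R]_(n + n) := \col_a pairing l (right_frame a q).
have dotE (s t : 'cV[R]_(n + n)) : (s^T *m t) 0 0 = \sum_(i < n + n) s i 0 * t i 0.
  by rewrite mxE; apply: eq_bigr => i _; rewrite [_^T _ _]mxE.
have lXE a : lX a 0 = pairing l (right_frame a q) by rewrite mxE.
have w_x k : w (lshift n k) 0 = q 0 (yi k) by rewrite /w /frame_contact col_mxEu mxE.
have w_y k : w (rshift n k) 0 = - q 0 (xi k) by rewrite /w /frame_contact col_mxEd mxE.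
have xcE k : xc p k.+1 = q 0 (xi k) by [].
have ycE k : yc p k.+1 = q 0 (yi k) by exact: coord_y.
have lxE k : lam p k.+1 = l 0 (xi k) by [].
have lyE k : lam p (n + k).+1 = l 0 (yi k) by [].
have lzE : lam p (2 * n + 1) = l 0 zi by exact: coord_z.
transitivity ((lX^T *m invmx (gram (@heis_metric R n) (@right_frame R n) q) *m lX) 0 0).
  rewrite mxE exchange_big; apply: eq_bigr => b _; rewrite mxE mulr_suml.
  by apply: eq_bigr => a _; rewrite !mxE; ring.
rewrite invmx_gram -/w mulmxBr mulmx1 mulmxBl -scalemxAr -scalemxAl mxE.
have -> : (lX^T *m lX) 0 0 =
    \sum_(k < n) (lam p k.+1 ^+ 2 + lam p (n + k).+1 ^+ 2)
    + 2 * lam p (2 * n + 1) * (\sum_(k < n) yc p k.+1 * lam p k.+1)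
    + lam p (2 * n + 1) ^+ 2 * \sum_(k < n) yc p k.+1 ^+ 2.
  rewrite dotE big_split_ord /= -big_split /= !mulr_sumr -!big_split.
  apply: eq_bigr => k _; rewrite !lXE pairing_frame_x pairing_frame_y lxE lyE lzE ycE /=.
  ring.
congr (_ + _); rewrite mxE mxE [_ ^+ 2 / _]mulrC; congr (- (_^-1 * _)).
  congr (1 + _); rewrite dotE big_split_ord /= -big_split; apply: eq_bigr => k _.
  by rewrite w_x w_y xcE ycE /=; ring.
have wl : (w^T *m lX) 0 0 = - (\sum_(k < n) (xc p k.+1 * lam p (n + k).+1 - yc p k.+1 * lam p k.+1)
    - lam p (2 * n + 1) * \sum_(k < n) yc p k.+1 ^+ 2).
  rewrite dotE big_split_ord /= -big_split /= mulr_sumr -sumrB -sumrN.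
  apply: eq_bigr => k _; rewrite w_x w_y !lXE.
  rewrite pairing_frame_x pairing_frame_y xcE ycE lxE lyE lzE /=; ring.
rewrite mulmxA -(mulmxA _ w^T) mxE big_ord1 wl.
have -> : (lX^T *m w) 0 0 = (w^T *m lX) 0 0.
  by rewrite !dotE; apply: eq_bigr => i _; rewrite mulrC.
by rewrite wl mulrNN expr2.
Qed.

End SubRiemannianMetric.

(** * Degree in the momenta *)

Section MomentumDegree.
Variables (R : realType) (d : nat).
Notation A := (ratfun R (d + d)).
Implicit Types (f g : A).

(** Defined by recursion on the degree so that products can be treated by
    induction. *)
Fixpoint homogeneous (m : nat) (f : 'rV[R]_(d + d) -> R) : Prop :=
  if m is m'.+1 then exists g : 'I_d -> 'rV[R]_(d + d) -> R,
    (forall i, homogeneous m' (g i)) /\ forall p, f p = \sum_i rsubmx p 0 i * g i p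
  else exists c : 'rV[R]_d -> R, forall p, f p = c (lsubmx p).

Lemma homogeneousD m f g : homogeneous m f -> homogeneous m g -> homogeneous m (f + g).
Proof.
suff H (F G : 'rV[R]_(d + d) -> R) : homogeneous m F -> homogeneous m G ->
  homogeneous m (fun p => F p + G p) by exact: (H f g).
elim: m F G => [F G [c cP] [e eP]|m IH F G [c [cm cP]] [e [em eP]]].
  by exists (fun q => c q + e q) => p; rewrite cP eP.
exists (fun i p => c i p + e i p); split=> [i|p]; first exact: (IH _ _ (cm i) (em i)).
by rewrite cP eP -big_split; apply: eq_bigr => i _; rewrite mulrDr.
Qed.

Lemma homogeneousM k m f g :
  homogeneous k f -> homogeneous m g -> homogeneous (k + m) (f * g).
Proof.
suff H (F G : 'rV[R]_(d + d) -> R) : homogeneous k F -> homogeneous m G ->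
  homogeneous (k + m) (fun p => F p * G p) by exact: (H f g).
elim: k F G => [|k IH] F G.
  case=> c cP; rewrite add0n; elim: m G => [G [e eP]|m IH G [e [em eP]]].
    by exists (fun q => c q * e q) => p; rewrite cP eP.
  exists (fun i p => F p * e i p); split=> [i|p]; first exact: (IH _ (em i)).
  by rewrite eP mulr_sumr; apply: eq_bigr => i _; rewrite mulrCA.
case=> c [cm cP] hG; exists (fun i p => c i p * G p); split=> [i|p].
  exact: (IH _ _ (cm i) hG).
by rewrite cP mulr_suml; apply: eq_bigr => i _; rewrite mulrA.
Qed.

Lemma homogeneous_cst (c : R) : homogeneous 0 (rat_cst d c).
Proof. by exists (fun=> c). Qed.

Lemma homogeneous0 m : homogeneous m (0 : A).
Proof.
suff H : homogeneous m (fun=> 0) by exact: H.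
elim: m => [|m IH]; first by exists (fun=> 0).
by exists (fun _ _ => 0); split => // p; rewrite big1 // => i _; rewrite mulr0.
Qed.

Lemma homogeneousN m f : homogeneous m f -> homogeneous m (- f).
Proof.
rewrite (_ : - f = rat_cst d (-1) * f); last first.
  by apply: val_inj; apply/funext => p; rewrite /= funNE funME /= mulN1r.
by move=> hf; exact: (homogeneousM (homogeneous_cst _) hf).
Qed.

Lemma homogeneous_sum m (I : finType) (F : I -> A) :
  (forall i, homogeneous m (F i)) -> homogeneous m (\sum_i F i).
Proof.
move=> h; elim/big_ind : _ => //; [exact: homogeneous0 | exact: homogeneousD].
Qed.

Lemma homogeneous_nat k : homogeneous 0 (k%:R : A).
Proof. by exists (fun=> k%:R) => p; exact: (rmorph_nat (evaluate p)). Qed.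

Lemma homogeneous_position i : homogeneous 0 (position R i).
Proof. by exists (fun q => q 0 i) => p; rewrite mxE. Qed.

Lemma homogeneous_momentum i : homogeneous 1 (momentum R i).
Proof.
exists (fun j _ => (j == i)%:R); split=> [j|p]; first by exists (fun=> (j == i)%:R).
rewrite (bigD1 i) //= big1 ?addr0 => [|j /negPf ->]; last by rewrite mulr0.
by rewrite eqxx mulr1 mxE.
Qed.

Lemma homogeneous_expansion m (f : 'rV[R]_(d + d) -> R) : homogeneous m f ->
  exists c : {ffun 'I_m -> 'I_d} -> 'rV[R]_d -> R,
    forall p, f p = \sum_(t : {ffun 'I_m -> 'I_d})
                      c t (lsubmx p) * \prod_(k < m) rsubmx p 0 (t k).
Proof.
elim: m f => [f [c cP]|m IH f [g [gm gP]]].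
  exists (fun _ => c) => p; rewrite (eq_bigr (fun=> c (lsubmx p))) => [|t _].
    by rewrite sumr_const card_ffun !card_ord expn0 cP.
  by rewrite big_ord0 mulr1.
have /choice[c cP] : forall i, exists c : {ffun 'I_m -> 'I_d} -> 'rV[R]_d -> R,
    forall p, g i p = \sum_(t : {ffun 'I_m -> 'I_d})
                      c t (lsubmx p) * \prod_(k < m) rsubmx p 0 (t k).
  by move=> i; exact: (IH _ (gm i)).
exists (fun t => c (t ord0) [ffun k => t (lift ord0 k)]) => p; rewrite gP.
pose h (u : 'I_d * {ffun 'I_m -> 'I_d}) : {ffun 'I_m.+1 -> 'I_d} :=
  [ffun k => oapp u.2 u.1 (unlift ord0 k)].
rewrite (reindex h) /=; last first.
  exists (fun t => (t ord0, [ffun k => t (lift ord0 k)])) => [[i t] _|t _].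
    congr pair; first by rewrite ffunE unlift_none.
    by apply/ffunP => k; rewrite !ffunE liftK.
  by apply/ffunP => k; rewrite ffunE; case: unliftP => [j ->|->] //=; rewrite ffunE.
rewrite -(pair_bigA _ (fun i t => c (h (i, t) ord0) [ffun k => h (i, t) (lift ord0 k)] (lsubmx p) *
    \prod_(k < m.+1) rsubmx p 0 (h (i, t) k))) /=.
apply: eq_bigr => i _; rewrite cP mulr_sumr; apply: eq_bigr => t _.
rewrite big_ord_recl ffunE unlift_none /= mulrCA; congr (_ * (_ * _)).
  by congr (c i _ _); apply/ffunP => k; rewrite !ffunE liftK.
by apply: eq_bigr => k _; rewrite ffunE liftK.
Qed.

End MomentumDegree.

(** * The first integrals as rational functions *)

Section HeisenbergIntegrals.
Variables (R : realType) (n : nat) (o a : 'I_n).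
Hypotheses (o0 : o = 0%N :> nat) (a1 : (1 < n)%N -> a = 1%N :> nat).
Notation d := (n + n).+1.
Notation A := (ratfun R (d + d)).
Local Notation br := (@rat_bracket R d).
Local Notation x := (@hx R n).
Local Notation y := (@hy R n).
Local Notation u := (@hu R n).
Local Notation v := (@hv R n).
Local Notation L := (hL R n).
Local Notation H := (rat_hamiltonian R n).
Local Notation spec := (integral_spec x y u v L (one_half R n) (r2_inverse R n) o a).
Local Notation center := (center_spec x y u v L (one_half R n) (r2_inverse R n)).

(** Below nb_integrals n, insubd never takes its default value. *)
Definition rational_integral (i : nat) : A :=
  if i == 0%N then H
  else if (i <= n)%N then plane_rotation x y u v (insubd o i.-1)
  else if (i < 2 * n)%N then minor2 x y u v o (insubd o (i - n)%N)
  else if i == (2 * n)%N then L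
  else triple x y u v o a (insubd o (i - 2 * n).+1).

Lemma rational_integral_spec i : (i < nb_integrals n)%N -> spec i (rational_integral i).
Proof.
rewrite /nb_integrals /rational_integral => inb; have n0 := ltn_ord o.
have [->|i0] := eqVneq i 0%N; first by left; constructor 1.
have [i1|i1] := leqP i n.
  left; constructor 2; exists (insubd o i.-1); rewrite insubdK //; last by rewrite unfold_in /=; lia.
  by split; [lia|].
have [i2|i2] := ltnP i (2 * n).
  left; constructor 3; exists (insubd o (i - n)%N).
  by rewrite insubdK //; [split => //; lia | rewrite unfold_in /=; lia].
have [->|i3] := eqVneq i (2 * n)%N; first by left; constructor 4; split => //; lia.
right; exists (insubd o (i - 2 * n).+1).
rewrite insubdK //; last by rewrite unfold_in /=; lia.
by split => //; [lia | apply: a1; lia | lia].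
Qed.

Lemma br_minor2E (k : 'I_n) : (1 < k)%N ->
  br (minor2 x y u v o a) (minor2 x y u v o k) = triple x y u v o a k.
Proof.
move=> k1; have a1' : a = 1%N :> nat by apply: a1; exact: ltn_trans k1 (ltn_ord k).
by apply: (br_minor2 (rat_bracketP R d) (heisenberg_frame R n));
  rewrite -val_eqE /= ?o0 ?a1' ?neq_ltn ?k1 // ltnW.
Qed.

Lemma minor2E (k : 'I_n) :
  (fun p => Pf k p ^+ 2 + Qf k p ^+ 2) = minor2 x y u v o k.
Proof.
apply/funext => p.
have -> : Pf k p = evaluate p (Pgen x y u v o k) := congr1 (@^~ p) (PfE R o0 k).
have -> : Qf k p = evaluate p (Qgen x y u v o k) := congr1 (@^~ p) (QfE R o0 k).
have <- : evaluate p (minor2 x y u v o k) =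
    evaluate p (Pgen x y u v o k) ^+ 2 + evaluate p (Qgen x y u v o k) ^+ 2.
  by rewrite /minor2 evaluateD 2!evaluateM 2!expr2.
exact: erefl.
Qed.

Lemma heis_integralE i : (i < nb_integrals n)%N ->
  @heis_integral R n i = rational_integral i.
Proof.
rewrite /nb_integrals /heis_integral /rational_integral => inb.
have n0 := ltn_ord o; case: ifP => [_|i0]; first exact: heis_hamiltonianE.
case: ifP => [i1|i1].
  apply/funext => p; set k := insubd o i.-1.
  have ki : i = k.+1 by rewrite /k insubdK //; [lia | rewrite unfold_in /=; lia].
  transitivity (evaluate p (plane_rotation x y u v k)) => //.
  by rewrite !atE !evE ki addnS; field; rewrite ?pnatr_eq0.
case: ifP => [i2|i2].
  rewrite -minor2E insubdK // unfold_in /=; lia.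
case: ifP => [i3|i3]; first by apply/funext => p; rewrite hL_lam.
set k := insubd o _.
have ki : (i - 2 * n).+1 = k by rewrite /k insubdK // unfold_in /=; lia.
have a1' : a = 1%N :> nat by apply: a1; lia.
have ea := minor2E a; rewrite a1' in ea; have ek := minor2E k; rewrite -ki in ek.
rewrite -br_minor2E; last by rewrite -ki; lia.
transitivity (poisson (minor2 x y u v o a) (minor2 x y u v o k)); last exact: erefl.
by rewrite -ea -ek.
Qed.

Definition generic_point : phase R n :=
  row_mx (delta_mx 0 (x_index o)) (\row_(i < d) (i < n)%:R).

Lemma generic_x k : evaluate generic_point (x k) = (k == o)%:R.
Proof. by rewrite /evaluate /= /generic_point row_mxEl mxE eqxx indexE. Qed.

Lemma generic_y k : evaluate generic_point (y k) = 0.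
Proof. by rewrite /evaluate /= /generic_point row_mxEl mxE eqxx indexE. Qed.

Lemma generic_L : evaluate generic_point L = 0.
Proof.
rewrite /evaluate /= /generic_point row_mxEr mxE z_indexK.
by rewrite ltnNge leq_addr.
Qed.

Lemma generic_u k : evaluate generic_point (u k) = 1.
Proof.
rewrite !atE generic_L mulr0 addr0 /evaluate /= /generic_point row_mxEr mxE x_indexK.
by rewrite ltn_ord.
Qed.

Lemma generic_v k : evaluate generic_point (v k) = 0.
Proof.
rewrite !atE generic_L mulr0 addr0 /evaluate /= /generic_point row_mxEr mxE y_indexK.
by rewrite ltnNge leq_addr.
Qed.

Lemma rational_integrals_free m (f : 'I_m -> A) : (forall i : 'I_m, spec i (f i)) ->
  row_free (gradient_mx f generic_point).
Proof.
move=> fs; apply: gradient_mx_row_free => c c0.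
exact: (integrals_independent (rat_bracketP R d) (heisenberg_frame R n)
  (half2 R n) o0 generic_x generic_y generic_u generic_v generic_L fs c0).
Qed.

Lemma center_free m (f : 'I_m -> A) : a != o -> (forall i : 'I_m, center i (f i)) ->
  row_free (gradient_mx f generic_point).
Proof.
move=> ao fs; apply: gradient_mx_row_free => c c0.
exact: (center_independent (rat_bracketP R d) (heisenberg_frame R n)
  (half2 R n) o0 generic_x generic_y generic_u generic_v generic_L ao fs c0).
Qed.

End HeisenbergIntegrals.

(** * Degrees of the integrals *)

Section IntegralDegrees.
Variables (R : realType) (n : nat).
Notation d := (n + n).+1.
Notation A := (ratfun R (d + d)).
Local Notation x := (@hx R n).
Local Notation y := (@hy R n).
Local Notation u := (@hu R n).
Local Notation v := (@hv R n).
Local Notation L := (hL R n).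
Local Notation c := (one_half R n).
Implicit Types (f g : A) (i j k : 'I_n).

Lemma homogeneousB m f g : homogeneous m f -> homogeneous m g -> homogeneous m (f - g).
Proof. by move=> hf hg; apply: homogeneousD => //; exact: homogeneousN. Qed.

Lemma homogeneous0M m f g : homogeneous 0 f -> homogeneous m g -> homogeneous m (f * g).
Proof. exact: (@homogeneousM _ _ 0). Qed.

Lemma homogeneous11 f g : homogeneous 1 f -> homogeneous 1 g -> homogeneous 2 (f * g).
Proof. exact: (@homogeneousM _ _ 1 1). Qed.

Lemma homogeneous_x k : homogeneous 0 (x k). Proof. exact: homogeneous_position. Qed.
Lemma homogeneous_y k : homogeneous 0 (y k). Proof. exact: homogeneous_position. Qed.
Lemma homogeneous_L : homogeneous 1 L. Proof. exact: homogeneous_momentum. Qed.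
Lemma homogeneous_half : homogeneous 0 c. Proof. exact: homogeneous_cst. Qed.

Lemma homogeneous_u k : homogeneous 1 (u k).
Proof.
apply: homogeneousD; first exact: homogeneous_momentum.
apply: homogeneous0M homogeneous_L; apply: homogeneous0M (homogeneous_y k).
exact: homogeneous_half.
Qed.

Lemma homogeneous_v k : homogeneous 1 (v k).
Proof.
apply: homogeneousD; first exact: homogeneous_momentum.
apply: homogeneous0M homogeneous_L; apply: homogeneous0M (homogeneous_x k).
exact: homogeneous_half.
Qed.

Let xu i k : homogeneous 1 (x i * u k).
Proof. exact: homogeneous0M (homogeneous_x i) (homogeneous_u k). Qed.
Let xv i k : homogeneous 1 (x i * v k).
Proof. exact: homogeneous0M (homogeneous_x i) (homogeneous_v k). Qed.
Let yu i k : homogeneous 1 (y i * u k).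
Proof. exact: homogeneous0M (homogeneous_y i) (homogeneous_u k). Qed.
Let yv i k : homogeneous 1 (y i * v k).
Proof. exact: homogeneous0M (homogeneous_y i) (homogeneous_v k). Qed.

Lemma homogeneous_plane_rotation k : homogeneous 1 (plane_rotation x y u v k).
Proof. exact: homogeneousB (xv k k) (yu k k). Qed.

Lemma homogeneous_gens i k :
  [/\ homogeneous 1 (Pgen x y u v i k), homogeneous 1 (Qgen x y u v i k),
      homogeneous 1 (Rgen x y u v i k) & homogeneous 1 (Sgen x y u v i k)].
Proof.
split.
- exact: homogeneousB (homogeneousD (homogeneousB (yu k i) (xv i k)) (xv k i)) (yu i k).
- exact: homogeneousD (homogeneousB (homogeneousB (xu i k) (xu k i)) (yv i k)) (yv k i).
- exact: homogeneousB (homogeneousD (homogeneousB (xu i k) (xu k i)) (yv i k)) (yv k i).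
- exact: homogeneousB (homogeneousB (homogeneousD (xv i k) (xv k i)) (yu i k)) (yu k i).
Qed.

Lemma homogeneous_minor2 i k : homogeneous 2 (minor2 x y u v i k).
Proof.
have [hP hQ _ _] := homogeneous_gens i k.
by apply: homogeneousD; exact: homogeneous11.
Qed.

Lemma homogeneous_triple i j k : homogeneous 3 (triple x y u v i j k).
Proof.
have [hP hQ _ _] := homogeneous_gens i k; have [hPj hQj _ _] := homogeneous_gens i j.
have [_ _ hR hS] := homogeneous_gens j k.
apply: homogeneous0M; first exact: (homogeneous_nat _ _ 4).
apply: homogeneousD; apply: (@homogeneousM _ _ 1 2) => //.
  by apply: homogeneousB; exact: homogeneous11.
by apply: homogeneousD; exact: homogeneous11.
Qed.

Lemma homogeneous_radius2 : homogeneous 0 (radius2 x y).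
Proof.
apply: homogeneous_sum => k; apply: homogeneousD; apply: homogeneous0M;
  by [exact: homogeneous_x | exact: homogeneous_y].
Qed.

(** It only depends on the positions, as does radius2. *)
Lemma homogeneous_r2_inverse : homogeneous 0 (r2_inverse R n).
Proof.
have [e eP] := homogeneous_radius2; exists (fun q => (1 + e q)^-1) => p.
by rewrite -eP.
Qed.

Lemma homogeneous_hamiltonian : homogeneous 2 (rat_hamiltonian R n).
Proof.
have hK : homogeneous 2 (kinetic u v).
  apply: homogeneous_sum => k; apply: homogeneousD; apply: homogeneous11;
    by [exact: homogeneous_u | exact: homogeneous_v].
have hM : homogeneous 1 (rotation x y u v).
  by apply: homogeneous_sum => k; exact: homogeneousB (xv k k) (yu k k).
have hc := homogeneous_half; have hl := homogeneous_L.
have hr := homogeneous_radius2; have hw := homogeneous_r2_inverse.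
have h1 : homogeneous 1 (rotation x y u v - c * L * radius2 x y).
  apply: homogeneousB => //; apply: (@homogeneousM _ _ 1 0) => //.
  exact: homogeneous0M.
apply: homogeneous0M => //; apply: homogeneousB; last first.
  by apply: (@homogeneousM _ _ 2 0) => //; exact: homogeneous11.
apply: homogeneousD; first by apply: homogeneousB => //; exact: homogeneous11.
apply: (@homogeneousM _ _ 2 0) => //; apply: homogeneous11 => //.
by apply: homogeneous0M => //; exact: homogeneous0M.
Qed.

End IntegralDegrees.

(** * Integrability *)

Section IntegrabilityOfTheFlow.
Variables (R : realType) (n : nat) (o a : 'I_n).
Hypotheses (o0 : o = 0%N :> nat) (a1 : (1 < n)%N -> a = 1%N :> nat).
Notation d := (n + n).+1.
Notation A := (ratfun R (d + d)).
Local Notation br := (@rat_bracket R d).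
Local Notation x := (@hx R n).
Local Notation y := (@hy R n).
Local Notation u := (@hu R n).
Local Notation v := (@hv R n).
Local Notation L := (hL R n).
Local Notation c := (one_half R n).
Local Notation w := (r2_inverse R n).
Local Notation H := (@heis_hamiltonian R n).
Local Notation I := (@heis_integral R n).
Local Notation nb := (nb_integrals n).
Local Notation P := (rat_bracketP R d).
Local Notation F := (heisenberg_frame R n).

Lemma rat_bracket_eq (f g h : A) : br f g = h -> poisson f g = h.
Proof. by move=> <-. Qed.

Definition integral_family (i : 'I_nb) : A := rational_integral R o a i.

Lemma integral_familyE (i : 'I_nb) : I i = integral_family i.
Proof. exact: heis_integralE. Qed.

Lemma integral_family_spec (i : 'I_nb) :
  integral_spec x y u v L c w o a i (integral_family i).
Proof. exact: rational_integral_spec. Qed.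

Lemma range_integral_family :
  @heis_integrals R n = range (fun i : 'I_nb => integral_family i : phase R n -> R).
Proof.
apply/seteqP; split => [_ [i /= inb <-]|_ [i _ <-]].
  by exists (Ordinal inb) => //; rewrite -integral_familyE.
by exists i; [exact: ltn_ord | exact: integral_familyE].
Qed.

Lemma integrals_free : row_free (gradient_mx (fun i : 'I_nb => I i) (generic_point R o)).
Proof.
have -> : (fun i : 'I_nb => I i) = (fun i => integral_family i : phase R n -> R).
  by apply/funext => i; exact: integral_familyE.
exact: (rational_integrals_free o0 integral_family_spec).
Qed.

Lemma integrals_null :
  lebesgue_null [set p | ~~ row_free (\matrix_(i < nb) gradient (I i) p)].
Proof.
apply: dependent_null integrals_free => // i; rewrite integral_familyE.
exact: ratfunP.
Qed.

Definition center_family (i : 'I_(n + 3)) : A :=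
  if i == 0 :> nat then rat_hamiltonian R n
  else if (i <= n)%N then plane_rotation x y u v (insubd o i.-1)
  else if i == n.+1 :> nat then L else casimir x y u v.

Lemma center_family_spec (i : 'I_(n + 3)) : center_spec x y u v L c w i (center_family i).
Proof.
rewrite /center_family; have := ltn_ord i; have := ltn_ord o => n0 i3.
have [->|i0] := eqVneq (i : nat) 0%N; first by constructor 1.
have [i1|i1] := leqP i n.
  constructor 2; exists (insubd o i.-1); rewrite insubdK //; last by rewrite unfold_in /=; lia.
  by split; [lia|].
have [->|i2] := eqVneq (i : nat) n.+1; first by constructor 3.
by constructor 4; split => //; lia.
Qed.

(** An integral does not vanish identically, since its differential is nonzero
    at the generic point. *)
Lemma integral_momentum_degree m (i : 'I_nb) : homogeneous m (integral_family i) ->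
  momentum_degree m (I i).
Proof.
move=> hm; split; last by rewrite integral_familyE; exact: homogeneous_expansion.
apply: contrapT => /forallNP I0.
have If0 : I i = fun=> 0 by apply/funext => p; apply/eqP/negP => /negP; exact: I0.
have /row_free_inj := integrals_free => /(_ 1%N) inj.
have : delta_mx 0 i = 0 :> 'rV[R]_nb.
  by apply: inj; rewrite mul0mx -rowE rowK If0 gradient0.
by move/rowP/(_ i)/eqP; rewrite !mxE !eqxx oner_eq0.
Qed.

Lemma integral_family_degree (i : 'I_nb) :
  exists2 m, m \in [:: 1; 2; 3]%N & homogeneous m (integral_family i).
Proof.
case: (integral_family_spec i) =>
    [[[_ ->]|[k [_ ->]]|[k [_ _ ->]]|[_ ->]]|[k [_ _ _ ->]]].
- by exists 2%N => //; exact: homogeneous_hamiltonian.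
- by exists 1%N => //; exact: homogeneous_plane_rotation.
- by exists 2%N => //; exact: homogeneous_minor2.
- by exists 1%N => //; exact: homogeneous_L.
- by exists 3%N => //; exact: homogeneous_triple.
Qed.

Lemma heis_integrals_degree f : heis_integrals (R := R) (n := n) f ->
  exists2 m, m \in [:: 1; 2; 3]%N & momentum_degree m f.
Proof.
move=> [i inb <-]; have [m mm hm] := integral_family_degree (Ordinal inb).
by exists m => //; exact: (integral_momentum_degree hm).
Qed.

Lemma heis_integrals_all_degrees m : (2 < n)%N -> m \in [:: 1; 2; 3]%N ->
  exists2 f, heis_integrals (R := R) (n := n) f & momentum_degree m f.
Proof.
move=> n2; have ex i k : (i < nb)%N ->
    (forall inb : (i < nb)%N, homogeneous k (integral_family (Ordinal inb))) ->
    exists2 f, heis_integrals (R := R) (n := n) f & momentum_degree k f.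
  move=> inb hk; exists (I i); first by exists i.
  exact: (integral_momentum_degree (hk inb)).
rewrite !inE => /or3P[] /eqP ->.
- apply: (ex (2 * n)%N) => [|inb]; first by rewrite /nb_integrals; lia.
  rewrite /integral_family /rational_integral /=.
  by rewrite 3?[if _ then _ else _]ifF ?eqxx; [exact: homogeneous_L | lia..].
- apply: (ex 0%N) => [|inb]; first by rewrite /nb_integrals; lia.
  exact: homogeneous_hamiltonian.
- apply: (ex (2 * n + 1)%N) => [|inb]; first by rewrite /nb_integrals; lia.
  rewrite /integral_family /rational_integral /=.
  by rewrite !ifF; [exact: homogeneous_triple | lia..].
Qed.

Lemma heis_first_integral i : (i < nb)%N -> first_integral H (I i).
Proof.
move=> inb; rewrite (integral_familyE (Ordinal inb)); split.
  exact: rational_smooth (ratfunP _).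
move=> p; rewrite heis_hamiltonianE.
have hH : center_spec x y u v L c w 0 (rat_hamiltonian R n) by constructor 1.
have := integral_center P F (half2 R n) (r2_inverseP R n) o0
  (integral_family_spec (Ordinal inb)) hH.
by move/(congr1 (evaluate p)).
Qed.

Lemma generator_brackets (k : 'I_n) : a = 1%N :> nat -> (2 <= k)%N ->
  [/\ poisson (@Pf R n 1) (@Pf R n k) = @Rf R n k,
      poisson (@Qf R n 1) (@Qf R n k) = @Rf R n k,
      poisson (@Pf R n 1) (@Qf R n k) = @Sf R n k
    & poisson (@Pf R n k) (@Qf R n 1) = @Sf R n k].
Proof.
move=> a1' k2.
have oa : o != a by rewrite -val_eqE /= o0 a1'.
have ok : o != k by rewrite -val_eqE /= o0; case: (k : nat) k2.
have ak : a != k by rewrite -val_eqE /= a1'; case: (k : nat) k2 => [|[]].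
have [[[pp qq] pq] kj] := br_gens P F oa ok ak.
have Pa := PfE R o0 a; have Qa := QfE R o0 a; rewrite a1' in Pa Qa.
rewrite Pa Qa (PfE R o0 k) (QfE R o0 k) (RfE R k a1') (SfE R k a1').
by split; apply: rat_bracket_eq.
Qed.

Lemma minor2_integral (k : 'I_n) : (0 < k)%N -> I (n + k)%N = minor2 x y u v o k.
Proof.
move=> k0; have kn := ltn_ord k; rewrite (heis_integralE R o0 a1) /nb_integrals; last lia.
rewrite /rational_integral 2?[if _ then _ else _]ifF; [|lia..].
rewrite ifT; last lia.
by rewrite addKn (_ : insubd o _ = k) //; apply: val_inj; rewrite insubdK.
Qed.

Lemma triple_integral (k : 'I_n) : (1 < k)%N -> I (2 * n + k.-1)%N = triple x y u v o a k.
Proof.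
move=> k1; have kn := ltn_ord k; rewrite (heis_integralE R o0 a1) /nb_integrals; last lia.
rewrite /rational_integral 4?[if _ then _ else _]ifF; [|lia..].
rewrite (_ : insubd o _ = k) //.
by apply: val_inj; rewrite insubdK ?unfold_in /=; lia.
Qed.

Lemma triple_bracket (k : 'I_n) : a = 1%N :> nat -> (1 < k)%N ->
  I (2 * n + k.-1)%N = poisson (I (n + 1)%N) (I (n + k)%N).
Proof.
move=> a1' k1; have a0 : (0 < a)%N by rewrite a1'.
have ea := minor2_integral a0; rewrite a1' in ea.
rewrite ea (minor2_integral (ltnW k1)) (triple_integral k1).
by rewrite -(br_minor2E R o0 a1 k1).
Qed.

Lemma triple_formula (k : 'I_n) p : a = 1%N :> nat -> (1 < k)%N ->
  I (2 * n + k.-1)%N p =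
    4 * (Pf k p * (Pf 1 p * Rf k p - Qf 1 p * Sf k p)
         + Qf k p * (Pf 1 p * Sf k p + Qf 1 p * Rf k p)).
Proof.
move=> a1' k1; rewrite triple_integral //.
have Pa := PfE R o0 a; have Qa := QfE R o0 a; rewrite a1' in Pa Qa.
rewrite Pa Qa (PfE R o0 k) (QfE R o0 k) (RfE R k a1') (SfE R k a1').
have E (p1 q1 p2 q2 r s : A) :
    evaluate p (4 * (p2 * (p1 * r - q1 * s) + q2 * (p1 * s + q1 * r))) =
    4 * (evaluate p p2 * (evaluate p p1 * evaluate p r - evaluate p q1 * evaluate p s)
         + evaluate p q2 * (evaluate p p1 * evaluate p s + evaluate p q1 * evaluate p r)).
  by rewrite !atE.
exact: E.
Qed.

(** The criterion with the integrals for f and the commuting functions of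
    center_spec for g. *)
Lemma heis_complete_noncommutative : (2 < n)%N ->
  complete_algebra H (lie_generated (@heis_integrals R n)) (3 * n - 1) (n + 3).
Proof.
move=> n2; have -> : (3 * n - 1)%N = nb by rewrite /nb_integrals; lia.
have ao : a != o by rewrite -val_eqE /= o0 a1 //; lia.
have gg := center_free o0 ao center_family_spec.
have ff := rational_integrals_free o0 integral_family_spec.
apply: (complete_algebra_criterion _ _ range_integral_family _ _ _ _ ff gg) => //.
- by rewrite /nb_integrals; lia.
- by move=> i; exact: ratfunP.
- by move=> i; exact: ratfunP.
- move=> i j; apply: (rat_bracket_eq (h := 0)); exact: (integral_center P F (half2 R n) (r2_inverseP R n) o0
    (integral_family_spec i) (center_family_spec j)).
- move=> i j; apply: (rat_bracket_eq (h := 0)); exact: (center_center P F (half2 R n) (r2_inverseP R n)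
    (center_family_spec i) (center_family_spec j)).
- have i0 : (0 < n + 3)%N by lia.
  by exists (Ordinal i0) => //; rewrite heis_hamiltonianE.
Qed.

Lemma integral_family_commute (i j : 'I_nb) : (n <= 2)%N ->
  poisson (integral_family i) (integral_family j) = 0.
Proof.
move=> n2; apply: (rat_bracket_eq (h := 0)); exact: (integrals_commute P F (half2 R n) (r2_inverseP R n) o0 n2
    (integral_family_spec i) (integral_family_spec j)).
Qed.

(** Here the family of integrals plays both parts in the criterion. *)
Lemma heis_complete_commutative : (n <= 2)%N ->
  complete_algebra H (lie_generated (@heis_integrals R n)) (2 * n + 1) (2 * n + 1).
Proof.
move=> n2; have -> : (2 * n + 1)%N = nb by rewrite /nb_integrals; lia.
have ff := rational_integrals_free o0 integral_family_spec.
apply: (complete_algebra_criterion _ _ range_integral_family _ _ _ _ ff ff) => //.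
- by rewrite /nb_integrals; lia.
- by move=> i; exact: ratfunP.
- by move=> i; exact: ratfunP.
- by move=> i j; exact: integral_family_commute.
- by move=> i j; exact: integral_family_commute.
- have i0 : (0 < nb)%N by rewrite /nb_integrals; lia.
  by exists (Ordinal i0) => //; rewrite heis_hamiltonianE.
Qed.

Lemma heis_integrals_rational f : heis_integrals (R := R) (n := n) f -> rational_fun f.
Proof. by rewrite range_integral_family => -[i _ <-]; exact: ratfunP. Qed.

Lemma heis_integrals_commute f g : (n <= 2)%N -> heis_integrals (R := R) (n := n) f ->
  heis_integrals (R := R) (n := n) g -> poisson f g = 0.
Proof.
rewrite range_integral_family => n2 [i _ <-] [j _ <-].
exact: integral_family_commute.
Qed.

End IntegrabilityOfTheFlow.

Theorem theorem3p3 (R : realType) (n : nat) (n_ge1 : (1 <= n)%N) :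
  let Hgeo := normal_hamiltonian (@heis_metric R n) (@right_frame R n) in
  let I := @heis_integral R n in
  let F := @heis_integrals R n in
  (* the normal geodesic flow and its Hamiltonian function *)
  (forall q, gram (@heis_metric R n) (@right_frame R n) q \in unitmx)
  /\ Hgeo = @heis_hamiltonian R n
  (* the functions I_i are first integrals *)
  /\ (forall i, (i < nb_integrals n)%N -> first_integral Hgeo (I i))
  (* R_j, S_j and I_(2n+l) as Poisson brackets, and the formula for the latter *)
  /\ (forall j, (2 <= j < n)%N ->
        [/\ poisson (@Pf R n 1) (@Pf R n j) = @Rf R n j,
            poisson (@Qf R n 1) (@Qf R n j) = @Rf R n j,
            poisson (@Pf R n 1) (@Qf R n j) = @Sf R n j
          & poisson (@Pf R n j) (@Qf R n 1) = @Sf R n j])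
  /\ (forall l, (1 <= l <= n - 2)%N ->
        I (2 * n + l)%N = poisson (I (n + 1)%N) (I (n + l + 1)%N)
        /\ forall p, I (2 * n + l)%N p =
             4 * (Pf l.+1 p * (Pf 1 p * Rf l.+1 p - Qf 1 p * Sf l.+1 p)
                  + Qf l.+1 p * (Pf 1 p * Sf l.+1 p + Qf 1 p * Rf l.+1 p)))
  (* functional independence almost everywhere *)
  /\ lebesgue_null
       [set p | ~~ row_free (\matrix_(i < nb_integrals n) gradient (I i) p)]
  (* the commutative case *)
  /\ ((n = 1 \/ n = 2)%N ->
        [/\ commutative_set F,
            complete_algebra Hgeo (lie_generated F) (2 * n + 1) (2 * n + 1)
          & liouville_integrable Hgeo])
  (* the non-commutative case *)
  /\ ((2 < n)%N ->
        [/\ nb_integrals n = (3 * n - 1)%N,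
            complete_algebra Hgeo (lie_generated F) (3 * n - 1) (n + 3),
            noncommutatively_integrable Hgeo,
            forall f, F f -> exists2 m, m \in [:: 1; 2; 3]%N & momentum_degree m f
          & forall m, m \in [:: 1; 2; 3]%N -> exists2 f, F f & momentum_degree m f]).
Proof.
pose o : 'I_n := Ordinal n_ge1; pose a : 'I_n := insubd o 1%N.
have o0 : o = 0%N :> nat by [].
have a1 : (1 < n)%N -> a = 1%N :> nat by move=> n1; rewrite insubdK.
move=> Hgeo I F; have HE : Hgeo = @heis_hamiltonian R n by exact: normal_hamiltonianE.
split; first exact: gram_unit.
split; first exact: HE.
split; first by move=> i inb; rewrite HE; exact: (heis_first_integral R o0 a1 inb).
split.
  move=> j /andP[j2 jn]; have a1' : a = 1%N :> nat by apply: a1; lia.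
  pose k : 'I_n := Ordinal jn.
  exact: (generator_brackets R o0 (k := k) a1').
split.
  move=> l /andP[l1 ln]; have a1' : a = 1%N :> nat by apply: a1; lia.
  have kn : (l.+1 < n)%N by lia.
  have -> : (n + l + 1 = n + l.+1)%N by lia.
  split=> [|p].
    exact: (triple_bracket R o0 a1 (k := Ordinal kn) a1').
  exact: (triple_formula o0 a1 (k := Ordinal kn) p a1').
split; first exact: (@integrals_null R n o a o0 a1).
split=> [n12|n2].
  have n2 : (n <= 2)%N by case: n12 => ->.
  have dE : (2 * n + 1)%N = (n + n).+1 by lia.
  rewrite HE; split.
  - by move=> f g Ff Fg p; rewrite (heis_integrals_commute o0 a1 n2 Ff Fg).
  - exact: (heis_complete_commutative R o0 a1 n2).
  - exists (lie_generated F); split.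
      apply: lie_generated_commutative => [f|f g]; first exact: (heis_integrals_rational o0 a1).
      exact: (heis_integrals_commute o0 a1 n2).
    by have := heis_complete_commutative R o0 a1 n2; rewrite dE.
rewrite HE; split.
- by rewrite /nb_integrals; lia.
- exact: (heis_complete_noncommutative R o0 a1 n2).
- by exists (lie_generated F), (3 * n - 1)%N, (n + 3)%N; exact: (heis_complete_noncommutative R o0 a1 n2).
- exact: (heis_integrals_degree o0 a1).
- by move=> m; exact: (heis_integrals_all_degrees R o0 a1 n2).
Qed.
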